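(* Let $(G,E,\varphi)$ be a self-similar triple and let $R$ be a unital commutative $*$-ring. Suppose that for every $g\in G$ and every $v\in E^0$ there are at most finitely many minimal strongly fixed paths for $g$ with range $v$. Then $L_R(G,E)$ is simple if and only if $R$ is simple and (1) the graph $E$ is weakly-$G$-transitive; (2) every $G$-circuit has an entry; and (3) for every vertex $v$, and every $g\in G$ that fixes $Z(v)$ pointwise, $g$ is slack at $v$.
   Context: A unital commutative $*$-ring $R$ is a commutative ring with $1$ together with an involution $r\mapsto r^*$. A $*$-algebra over $R$ is an (associative, not necessarily unital) $R$-algebra with a map $a\mapsto a^*$ satisfying $(a^* )^*=a$, $(ab)^*=b^*a^*$, $(ra+b)^*=r^*a^*+b^*$. A projection is $p=p^*=p^2$; a partial isometry is $s=ss^*s$. Simple means having no nontrivial proper two-sided ideals (and being nonzero); so $R$ simple means $R$ is a field. A directed graph $E=(E^0,E^1,r,s)$ has countable vertex set $E^0$ (here nonempty), countable edge set $E^1$ and maps $r,s\colon E^1\to E^0$. It is row-finite if $vE^1:=r^{-1}(v)$ is finite for all $v$, and has no sources if $vE^1\neq\emptyset$ for all $v$. An action of a group $G$ on $E$ is a homomorphism from $G$ to the group of bijections of $E^0\sqcup E^1$ that preserve $E^0$ and $E^1$ and commute with $r$ and $s$. A self-similar triple $(G,E,\varphi)$: a countable discrete group $G$ (unit $e_G$), a row-finite graph $E$ with no sources, an action of $G$ on $E$, and a map $\varphi\colon G\times E^1\to G$ with $\varphi(gh,e)=\varphi(g,h\cdot e)\varphi(h,e)$ and $\varphi(g,e)\cdot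 v=g\cdot v$ for all $g,h\in G$, $e\in E^1$, $v\in E^0$. An $E$-family in a $*$-algebra: mutually orthogonal projections $P_v$ ($v\in E^0$) and partial isometries $S_e$ ($e\in E^1$) with $S_e^*S_f=\delta_{e,f}P_{s(e)}$ and $P_v=\sum_{e\in vE^1}S_eS_e^*$. A $(G,E)$-family: elements $P_{v,f}$, $S_{e,g}$ ($v\in E^0$, $e\in E^1$, $f,g\in G$) such that (a) $\{P_{v,e_G}\}\cup\{S_{e,e_G}\}$ is an $E$-family; (b) $(P_{v,f})^*=P_{f^{-1}\cdot v,f^{-1}}$; (c) $P_{v,f}P_{w,h}=\delta_{v,f\cdot w}P_{v,fh}$; (d) $P_{v,f}S_{e,g}=\delta_{v,r(f\cdot e)}S_{f\cdot e,\varphi(f,e)g}$; (e) $S_{e,g}P_{v,f}=\delta_{g\cdot v,s(e)}S_{e,gf}$. $L_R(G,E)$ is the universal $*$-algebra over $R$ generated by a $(G,E)$-family $\{p_{v,f},s_{e,g}\}$. Paths are $\alpha=\alpha_1\cdots\alpha_n$ with $\alpha_i\in E^1$, $s(\alpha_i)=r(\alpha_{i+1})$, $r(\alpha)=r(\alpha_1)$, $s(\alpha)=s(\alpha_n)$; vertices are paths of length $0$; $E^*$ is the set of finite paths, $E^\infty$ the set of infinite paths $e_1e_2\cdots$ ($s(e_i)=r(e_{i+1})$), and $Z(v)=\{x\in E^\infty:r(x)=v\}$. The action and cocycle extend to $E^*$ by $\varphi(g,v)=g$ for $v\in E^0$, $g\cdot(\alpha e)=(g\cdot\alpha)(\varphi(g,\alpha)\cdot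 e)$, $\varphi(g,\alpha e)=\varphi(\varphi(g,\alpha),e)$, and $G$ acts on $E^\infty$ so that $g\cdot x$ has initial segments $g\cdot(e_1\cdots e_n)$. A path $\alpha\in E^*$ is strongly fixed by $g$ if $g\cdot\alpha=\alpha$ and $\varphi(g,\alpha)=e_G$; it is a minimal strongly fixed path for $g$ if moreover no proper prefix of $\alpha$ is strongly fixed by $g$. $E$ is weakly-$G$-transitive if for every infinite path $\xi\in E^\infty$ and every vertex $x$ there are a vertex $v$ on $\xi$ (range or source of an edge of $\xi$), a group element $g\in G$ and a path $\alpha\in E^*$ with $r(\alpha)=x$ and $s(\alpha)=g\cdot v$. A $G$-circuit is a pair $(g,\gamma)$ with $g\in G$ and $\gamma\in E^*$ of length $\ge1$ with $s(\gamma)=g\cdot r(\gamma)$; it has an entry if $r^{-1}(r(\gamma_i))$ has more than one element for some edge $\gamma_i$ of $\gamma$. $g$ is slack at $v$ if there is $n\ge0$ such that every $\alpha\in E^*$ with $r(\alpha)=v$ and $|\alpha|\ge n$ is strongly fixed by $g$. *)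

(* Defs.v *)
From HB Require Import structures.
From mathcomp Require Import all_boot all_order all_algebra.
From mathcomp Require Import boolp classical_sets functions cardinality fsbigop.

Set Implicit Arguments.
Unset Strict Implicit.
Unset Printing Implicit Defensive.

Import GRing.Theory.

Local Open Scope classical_set_scope.
Local Open Scope quotient_scope.
Local Open Scope ring_scope.

(* Two-sided ideals are those of the underlying, possibly non-unital, ring:
   invariance under a scalar action is not required. *)
Definition two_sided_ideal (A : zmodType) (mul : A -> A -> A) (I : set A) :=
  [/\ I 0,
      forall x y, I x -> I y -> I (x - y),
      forall a x, I x -> I (mul a x) &
      forall a x, I x -> I (mul x a)].

Definition simple_ring (A : zmodType) (mul : A -> A -> A) :=
  (exists a : A, a <> 0) /\
  forall I : set A, two_sided_ideal mul I -> I = [set 0] \/ I = setT.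

(* Associative, not necessarily unital, *-algebras over the commutative ring R
   with involution conj. *)
Record starAlgebra (R : comPzRingType) (conj : R -> R) := StarAlgebra {
  star_sort :> lmodType R;
  amul : star_sort -> star_sort -> star_sort;
  astar : star_sort -> star_sort;
  amulA : associative amul;
  amulDl : left_distributive amul +%R;
  amulDr : right_distributive amul +%R;
  ascalerAl : forall (r : R) a b, r *: amul a b = amul (r *: a) b;
  ascalerAr : forall (r : R) a b, r *: amul a b = amul a (r *: b);
  astarK : involutive astar;
  astarM : forall a b, astar (amul a b) = amul (astar b) (astar a);
  astarZD : forall (r : R) a b,
    astar (r *: a + b) = conj r *: astar a + astar b
}.

Declare Scope star_scope.
Delimit Scope star_scope with star.
Notation "x ** y" := (amul x y) (at level 40, left associativity) : star_scope.
Notation "x ^†" := (astar x) (at level 2, format "x ^†") : star_scope.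
Local Open Scope star_scope.

Definition star_hom (R : comPzRingType) (conj : R -> R)
    (A B : starAlgebra conj) (f : A -> B) :=
  [/\ forall (r : R) a b, f (r *: a + b) = r *: f a + f b,
      forall a b, f (a ** b) = f a ** f b &
      forall a, f (a^†) = (f a)^†].

Definition is_projection (R : comPzRingType) (conj : R -> R)
    (A : starAlgebra conj) (p : A) := p = p^† /\ p = p ** p.

Definition is_partial_isometry (R : comPzRingType) (conj : R -> R)
    (A : starAlgebra conj) (s : A) := s = s ** s^† ** s.

Record graph := Graph {
  vert : countType;
  edge : countType;
  rng : edge -> vert;
  src : edge -> vert;
  vert_nonempty : inhabited vert
}.

Definition row_finite (E : graph) :=
  forall v : vert E, finite_set [set e : edge E | rng e = v].

Definition no_sources (E : graph) :=
  forall v : vert E, [set e : edge E | rng e = v] !=set0.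

Record self_similar_triple (G : groupType) (E : graph) := SelfSimilarTriple {
  actV : G -> vert E -> vert E;
  actE : G -> edge E -> edge E;
  coc : G -> edge E -> G;
  ss_countable : countable [set: G];
  ss_row_finite : row_finite E;
  ss_no_sources : no_sources E;
  actV1 : forall v, actV 1%g v = v;
  actVM : forall g h v, actV (g * h)%g v = actV g (actV h v);
  actE1 : forall e, actE 1%g e = e;
  actEM : forall g h e, actE (g * h)%g e = actE g (actE h e);
  act_rng : forall g e, rng (actE g e) = actV g (rng e);
  act_src : forall g e, src (actE g e) = actV g (src e);
  cocM : forall g h e, coc (g * h)%g e = (coc g (actE h e) * coc h e)%g;
  coc_actV : forall g e v, actV (coc g e) v = actV g v
}.

Section Paths.
Variables (G : groupType) (E : graph) (X : self_similar_triple G E).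
Implicit Types (g h : G) (v : vert E) (e : edge E) (p q : seq (edge E)).

(* A finite path alpha is represented by the pair of the vertex v = r(alpha)
   and the list p of its edges, subject to is_path v p; the vertex v itself,
   as a path of length 0, is (v, [::]). *)
Fixpoint is_path v p : bool :=
  if p is e :: q then (rng e == v) && is_path (src e) q else true.

Definition path_src v p : vert E := last v [seq src e | e <- p].

Definition coc_path g p : G := foldl (coc X) g p.

Fixpoint act_path g p : seq (edge E) :=
  if p is e :: q then actE X g e :: act_path (coc X g e) q else [::].

Lemma coc_path_rcons g p e :
  coc_path g (rcons p e) = coc X (coc_path g p) e.
Proof. exact: foldl_rcons. Qed.

Lemma act_path_rcons g p e :
  act_path g (rcons p e) = rcons (act_path g p) (actE X (coc_path g p) e).
Proof. by elim: p g => //= f p IH g; rewrite IH. Qed.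

Lemma coc_path_actV g p v : actV X (coc_path g p) v = actV X g v.
Proof.
by elim/last_ind: p => //= p e IH; rewrite coc_path_rcons coc_actV.
Qed.

Lemma is_path_act g v p : is_path v p -> is_path (actV X g v) (act_path g p).
Proof.
elim: p g v => //= e p IH g v /andP[/eqP <- pp].
by rewrite act_rng eqxx /= act_src -(coc_actV X g e) IH.
Qed.

Lemma path_src_act g v p :
  path_src (actV X g v) (act_path g p) = actV X g (path_src v p).
Proof.
rewrite /path_src; elim: p g v => //= e p IH g v.
by rewrite act_src -(coc_actV X g e) IH coc_actV.
Qed.

Definition is_infpath (x : nat -> edge E) :=
  forall n, src (x n) = rng (x n.+1).

Definition act_inf g (x : nat -> edge E) : nat -> edge E :=
  fun n => actE X (coc_path g (mkseq x n)) (x n).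

Lemma act_inf_prefix g x n : mkseq (act_inf g x) n = act_path g (mkseq x n).
Proof.
by elim: n => // n IH; rewrite !mkseqS act_path_rcons IH.
Qed.

Definition strongly_fixed g v p :=
  [/\ actV X g v = v, act_path g p = p & coc_path g p = 1%g].

(* Proper prefixes include the length-0 path v. *)
Definition minimal_strongly_fixed g v p :=
  strongly_fixed g v p /\
  forall q, prefix q p -> q != p -> ~ strongly_fixed g v q.

Definition finitely_many_minimal_strongly_fixed :=
  forall g v,
    finite_set [set p | is_path v p /\ minimal_strongly_fixed g v p].

Definition weakly_G_transitive :=
  forall (xi : nat -> edge E) (x : vert E), is_infpath xi ->
  exists v : vert E, (exists i, v = rng (xi i) \/ v = src (xi i)) /\
  exists (g : G) (p : seq (edge E)), is_path x p /\ path_src x p = actV X g v.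

Definition G_circuit g v p :=
  [/\ is_path v p, (1 <= size p)%N & path_src v p = actV X g v].

Definition has_entry p :=
  exists2 e, e \in p &
  exists f1 f2 : edge E, [/\ f1 <> f2, rng f1 = rng e & rng f2 = rng e].

Definition fixes_cylinder g v :=
  forall x, is_infpath x -> rng (x 0%N) = v -> act_inf g x = x.

Definition slack g v :=
  exists n : nat, forall p, is_path v p -> (n <= size p)%N ->
  strongly_fixed g v p.

End Paths.

Section Families.
Variables (R : comPzRingType) (conj : R -> R).
Variables (G : groupType) (E : graph) (X : self_similar_triple G E).
Variable A : starAlgebra conj.

Record E_family (P : vert E -> A) (S : edge E -> A) : Prop := EFamily {
  ef_proj : forall v, is_projection (P v);
  ef_orth : forall v w, v <> w -> P v ** P w = 0;
  ef_piso : forall e, is_partial_isometry (S e);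
  ef_starS : forall e f, (S e)^† ** S f = if e == f then P (src e) else 0;
  ef_sum : forall v,
    P v = \sum_(e \in [set e : edge E | rng e = v]) S e ** (S e)^†
}.

Record GE_family (P : vert E -> G -> A) (S : edge E -> G -> A) : Prop :=
  GEFamily {
  gef_E : E_family (fun v => P v 1%g) (fun e => S e 1%g);
  gef_starP : forall v f, (P v f)^† = P (actV X f^-1%g v) f^-1%g;
  gef_PP : forall v f w h,
    P v f ** P w h = if v == actV X f w then P v (f * h)%g else 0;
  gef_PS : forall v f e g,
    P v f ** S e g =
      if v == rng (actE X f e) then S (actE X f e) (coc X f e * g)%g else 0;
  gef_SP : forall e g v f,
    S e g ** P v f = if actV X g v == src e then S e (g * f)%g else 0
}.

End Families.

(* The universal *-algebra L_R(G,E): formal *-algebra expressions in the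
   generators, identified when they take the same value at every (G,E)-family
   in every *-algebra over R. *)
Section Universal.
Variables (R : comPzRingType) (conj : {rmorphism R -> R}).
Variables (G : groupType) (E : graph) (X : self_similar_triple G E).

Inductive term : Type :=
  | TP of vert E & G
  | TS of edge E & G
  | TZero
  | TAdd of term & term
  | TScale of R & term
  | TMul of term & term
  | TStar of term.

HB.instance Definition _ := Choice.copy term {classic term}.

Fixpoint eval (B : starAlgebra conj) (P : vert E -> G -> B)
    (S : edge E -> G -> B) (t : term) : B :=
  match t with
  | TP v g => P v g
  | TS e g => S e g
  | TZero => 0
  | TAdd a b => eval P S a + eval P S b
  | TScale r a => r *: eval P S a
  | TMul a b => eval P S a ** eval P S b
  | TStar a => (eval P S a)^†
  end.

Definition term_equiv (t u : term) : Prop :=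
  forall (B : starAlgebra conj) (P : vert E -> G -> B) (S : edge E -> G -> B),
  GE_family X P S -> eval P S t = eval P S u.

Definition term_eqb (t u : term) : bool := `[< term_equiv t u >].

Lemma term_eqb_refl : reflexive term_eqb.
Proof. by move=> t; apply/asboolP. Qed.

Lemma term_eqb_sym : symmetric term_eqb.
Proof.
by move=> t u; apply/asboolP/asboolP => tu B P S PS; rewrite tu.
Qed.

Lemma term_eqb_trans : transitive term_eqb.
Proof.
move=> u t w /asboolP tu /asboolP uw; apply/asboolP => B P S PS.
by rewrite tu // uw.
Qed.

Definition term_eqrel := EquivRel term_eqb
  term_eqb_refl term_eqb_sym term_eqb_trans.

Definition LR_type : Type := {eq_quot term_eqrel}.
HB.instance Definition _ := Choice.on LR_type.
HB.instance Definition _ := EqQuotient.on LR_type.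

Definition cls (t : term) : LR_type := \pi_LR_type t.

Definition LR_eval (B : starAlgebra conj) (P : vert E -> G -> B)
  (S : edge E -> G -> B) (x : LR_type) : B := eval P S (repr x).

Lemma LR_eval_cls B P S t : @GE_family _ _ _ _ X B P S ->
  LR_eval P S (cls t) = eval P S t.
Proof.
move=> PS; have /eqmodP/asboolP tt : \pi_LR_type (repr (cls t)) = \pi_LR_type t.
  by rewrite reprK.
exact: tt.
Qed.

Lemma LR_ext (x y : LR_type) :
  (forall B P S, @GE_family _ _ _ _ X B P S -> LR_eval P S x = LR_eval P S y) ->
  x = y.
Proof.
move=> xy; rewrite -[x]reprK -[y]reprK.
by apply/eqmodP/asboolP => B P S PS; exact: xy.
Qed.

Lemma cls_repr (x : LR_type) : cls (repr x) = x.
Proof. exact: reprK. Qed.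

Definition LR_zero : LR_type := cls TZero.
Definition LR_add (x y : LR_type) := cls (TAdd (repr x) (repr y)).
Definition LR_scale (r : R) (x : LR_type) := cls (TScale r (repr x)).
Definition LR_opp (x : LR_type) := LR_scale (-1) x.
Definition LR_mul (x y : LR_type) := cls (TMul (repr x) (repr y)).
Definition LR_star (x : LR_type) := cls (TStar (repr x)).

Section Eval.
Variables (B : starAlgebra conj) (P : vert E -> G -> B) (S : edge E -> G -> B).
Hypothesis PS : GE_family X P S.

Lemma LR_eval0 : LR_eval P S LR_zero = 0.
Proof. exact: LR_eval_cls. Qed.
Lemma LR_evalD x y : LR_eval P S (LR_add x y) = LR_eval P S x + LR_eval P S y.
Proof. exact: LR_eval_cls. Qed.
Lemma LR_evalZ r x : LR_eval P S (LR_scale r x) = r *: LR_eval P S x.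
Proof. exact: LR_eval_cls. Qed.
Lemma LR_evalN x : LR_eval P S (LR_opp x) = - LR_eval P S x.
Proof. by rewrite LR_evalZ scaleN1r. Qed.
Lemma LR_evalM x y : LR_eval P S (LR_mul x y) = LR_eval P S x ** LR_eval P S y.
Proof. exact: LR_eval_cls. Qed.
Lemma LR_evalS x : LR_eval P S (LR_star x) = (LR_eval P S x)^†.
Proof. exact: LR_eval_cls. Qed.

Definition LR_evalE :=
  (LR_eval0, LR_evalD, LR_evalN, LR_evalZ, LR_evalM, LR_evalS).
End Eval.

Let LR_addA : associative LR_add.
Proof. by move=> x y z; apply: LR_ext => B P S PS; rewrite !LR_evalE // addrA. Qed.
Let LR_addC : commutative LR_add.
Proof. by move=> x y; apply: LR_ext => B P S PS; rewrite !LR_evalE // addrC. Qed.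
Let LR_add0 : left_id LR_zero LR_add.
Proof. by move=> x; apply: LR_ext => B P S PS; rewrite !LR_evalE // add0r. Qed.
Let LR_addN : left_inverse LR_zero LR_opp LR_add.
Proof. by move=> x; apply: LR_ext => B P S PS; rewrite !LR_evalE // addNr. Qed.

HB.instance Definition _ :=
  GRing.isZmodule.Build LR_type LR_addA LR_addC LR_add0 LR_addN.

Let LR_scaleA r s x : LR_scale r (LR_scale s x) = LR_scale (r * s) x.
Proof. by apply: LR_ext => B P S PS; rewrite !LR_evalE // scalerA. Qed.
Let LR_scale1 : left_id 1 LR_scale.
Proof. by move=> x; apply: LR_ext => B P S PS; rewrite !LR_evalE // scale1r. Qed.
Let LR_scaleDr : right_distributive LR_scale +%R.
Proof. by move=> r x y; apply: LR_ext => B P S PS; rewrite !LR_evalE // scalerDr. Qed.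
Let LR_scaleDl x : {morph LR_scale^~ x : r s / r + s}.
Proof. by move=> r s; apply: LR_ext => B P S PS; rewrite !LR_evalE // scalerDl. Qed.

HB.instance Definition _ := GRing.Zmodule_isLmodule.Build R LR_type
  LR_scaleA LR_scale1 LR_scaleDr LR_scaleDl.

Let LR_mulA : associative LR_mul.
Proof. by move=> x y z; apply: LR_ext => B P S PS; rewrite !LR_evalE // amulA. Qed.
Let LR_mulDl : left_distributive LR_mul +%R.
Proof. by move=> x y z; apply: LR_ext => B P S PS; rewrite !LR_evalE // amulDl. Qed.
Let LR_mulDr : right_distributive LR_mul +%R.
Proof. by move=> x y z; apply: LR_ext => B P S PS; rewrite !LR_evalE // amulDr. Qed.
Let LR_scaleAl (r : R) x y : r *: LR_mul x y = LR_mul (r *: x) y.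
Proof. by apply: LR_ext => B P S PS; rewrite !LR_evalE // ascalerAl. Qed.
Let LR_scaleAr (r : R) x y : r *: LR_mul x y = LR_mul x (r *: y).
Proof. by apply: LR_ext => B P S PS; rewrite !LR_evalE // ascalerAr. Qed.
Let LR_starK : involutive LR_star.
Proof. by move=> x; apply: LR_ext => B P S PS; rewrite !LR_evalE // astarK. Qed.
Let LR_starM x y : LR_star (LR_mul x y) = LR_mul (LR_star y) (LR_star x).
Proof. by apply: LR_ext => B P S PS; rewrite !LR_evalE // astarM. Qed.
Let LR_starZD (r : R) x y :
  LR_star (r *: x + y) = conj r *: LR_star x + LR_star y.
Proof. by apply: LR_ext => B P S PS; rewrite !LR_evalE // astarZD. Qed.

Definition LR : starAlgebra conj := @StarAlgebra R conj LR_type LR_mul LR_star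
  LR_mulA LR_mulDl LR_mulDr LR_scaleAl LR_scaleAr LR_starK LR_starM LR_starZD.

Definition LR_p (v : vert E) (g : G) : LR := cls (TP v g).
Definition LR_s (e : edge E) (g : G) : LR := cls (TS e g).

Lemma LR_eval_hom (B : starAlgebra conj) (P : vert E -> G -> B)
    (S : edge E -> G -> B) : GE_family X P S ->
  star_hom (LR_eval P S : LR -> B).
Proof.
by move=> PS; split=> *; rewrite /= ?(LR_evalE PS).
Qed.

Lemma LR_eval_p (B : starAlgebra conj) (P : vert E -> G -> B)
    (S : edge E -> G -> B) v g : GE_family X P S ->
  LR_eval P S (LR_p v g) = P v g.
Proof. by move=> PS; rewrite LR_eval_cls. Qed.

Lemma LR_eval_s (B : starAlgebra conj) (P : vert E -> G -> B)
    (S : edge E -> G -> B) e g : GE_family X P S ->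
  LR_eval P S (LR_s e g) = S e g.
Proof. by move=> PS; rewrite LR_eval_cls. Qed.

Lemma LR_eval_if (B : starAlgebra conj) (P : vert E -> G -> B)
    (S : edge E -> G -> B) (b : bool) (x : LR) : GE_family X P S ->
  LR_eval P S (if b then x else 0) = if b then LR_eval P S x else 0.
Proof. by move=> PS; case: b => //; rewrite LR_eval0. Qed.

Lemma LR_family : GE_family X LR_p LR_s.
Proof.
have evM B P S : @GE_family _ _ _ _ X B P S -> forall a b : LR,
    LR_eval P S (a ** b) = LR_eval P S a ** LR_eval P S b.
  by move=> PS; case: (LR_eval_hom PS).
have evS B P S : @GE_family _ _ _ _ X B P S -> forall a : LR,
    LR_eval P S (a^†) = (LR_eval P S a)^†.
  by move=> PS; case: (LR_eval_hom PS).
pose evE B P S (PS : @GE_family _ _ _ _ X B P S) :=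
  (evM _ _ _ PS, evS _ _ _ PS, fun v g => LR_eval_p v g PS,
   fun e g => LR_eval_s e g PS, fun b x => LR_eval_if b x PS).
split; first split.
- move=> v; split; apply: LR_ext => B P S PS; rewrite !(evE _ _ _ PS);
    by case: (ef_proj (gef_E PS) v).
- move=> v w vw; apply: LR_ext => B P S PS.
  by rewrite !(evE _ _ _ PS) (ef_orth (gef_E PS) vw) LR_eval0.
- move=> e; apply: LR_ext => B P S PS; rewrite !(evE _ _ _ PS).
  exact: (ef_piso (gef_E PS)).
- move=> e f; apply: LR_ext => B P S PS; rewrite !(evE _ _ _ PS).
  exact: (ef_starS (gef_E PS)).
- move=> v; apply: LR_ext => B P S PS; rewrite !(evE _ _ _ PS).
  have fin := ss_row_finite X v.
  rewrite (ef_sum (gef_E PS)) !(fsbig_finite _ _ fin) /=.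
  rewrite (big_morph (LR_eval P S) (LR_evalD PS) (LR_eval0 PS)).
  by apply: eq_bigr => e _; rewrite !(evE _ _ _ PS).
- move=> v f; apply: LR_ext => B P S PS; rewrite !(evE _ _ _ PS).
  exact: (gef_starP PS).
- move=> v f w h; apply: LR_ext => B P S PS; rewrite !(evE _ _ _ PS).
  exact: (gef_PP PS).
- move=> v f e g; apply: LR_ext => B P S PS; rewrite !(evE _ _ _ PS).
  exact: (gef_PS PS).
- move=> e g v f; apply: LR_ext => B P S PS; rewrite !(evE _ _ _ PS).
  exact: (gef_SP PS).
Qed.

Lemma LR_universal (B : starAlgebra conj) (P : vert E -> G -> B)
    (S : edge E -> G -> B) : GE_family X P S ->
  exists! f : LR -> B, [/\ star_hom f, forall v g, f (LR_p v g) = P v g &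
                           forall e g, f (LR_s e g) = S e g].
Proof.
move=> PS; exists (LR_eval P S); split.
  split; first exact: LR_eval_hom.
  - by move=> v g; exact: LR_eval_p.
  - by move=> e g; exact: LR_eval_s.
move=> f [[fL fM fS] fp fs]; apply/funext => x.
have fD a b : f (a + b) = f a + f b by rewrite -[a]scale1r fL !scale1r.
have f0 : f 0 = 0 by apply: (addrI (f 0)); rewrite -fD !addr0.
have fZ r a : f (r *: a) = r *: f a by rewrite -[r *: a]addr0 fL f0 addr0.
rewrite -[x]cls_repr LR_eval_cls //; elim: (repr x) => /=.
- by move=> v g; rewrite -fp.
- by move=> e g; rewrite -fs.
- exact/esym/f0.
- move=> t -> u ->; rewrite -fD; congr f; apply: LR_ext => B' P' S' PS'.
  by rewrite LR_evalD // !LR_eval_cls.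
- move=> r t ->; rewrite -fZ; congr f; apply: LR_ext => B' P' S' PS'.
  by rewrite LR_evalZ // !LR_eval_cls.
- move=> t -> u ->; rewrite -fM; congr f; apply: LR_ext => B' P' S' PS'.
  by rewrite LR_evalM // !LR_eval_cls.
- move=> t ->; rewrite -fS; congr f; apply: LR_ext => B' P' S' PS'.
  by rewrite LR_evalS // !LR_eval_cls.
Qed.

End Universal.

(* Main.v *)
From HB Require Import structures.
Require Import Defs.
From mathcomp Require Import all_boot all_order all_algebra.
From mathcomp Require Import boolp classical_sets functions cardinality fsbigop.

Set Implicit Arguments.
Unset Strict Implicit.
Unset Printing Implicit Defensive.

Import GRing.Theory.

Local Open Scope ring_scope.
Local Open Scope star_scope.

(* Sufficiency. Multiplying a nonzero element of an ideal I by s_beta for a long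
   path beta turns it into a combination of monomials s_alpha u_g. Choose such a
   combination, nonzero and in I, with the fewest terms. Finiteness of the
   minimal strongly fixed paths then makes the terms of equal path length differ
   on all paths, and conditions (2) and (3) provide a path r such that
   compressing by s_(alpha . g r) and s_r kills all the terms except one of
   least path length. So I contains a vertex projection; the vertices v with
   p_v in I are closed under sources, under G and under "all edges into v start
   in the set", whence by (1) they are all the vertices.

   Necessity. L_R(G,E) acts on the functions on triples (x, k, c), where x is an
   infinite path, k an integer and c a sequence in G modulo eventual equality; g
   multiplies c by the sequence phi(g, x_1...x_n), and removing the first edge
   shifts c and decreases k. If N and K are submodules stable under the
   generators, the a with aN in K form an ideal. Taking K to be the J-valued
   functions, the functions that vanish on the paths whose vertices all connect
   to a given path, and 0 (with N the functions that depend on x only) gives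
   simplicity of R, (1), and (2) and (3): the coordinates k and c distinguish
   elements that agree on functions of x only. *)

(** * Paths under a self-similar action, strongly fixed paths, infinite paths *)

Section SelfSimilarPaths.
Variables (G : groupType) (E : graph) (X : self_similar_triple G E).
Implicit Types (g h : G) (v w : vert E) (e : edge E) (p q : seq (edge E)).

Lemma coc1 e : coc X 1%g e = 1%g.
Proof.
apply: (@mulIg _ (coc X 1%g e)).
by rewrite mul1g -{1}(actE1 X e) -cocM mulg1.
Qed.

Lemma actVK g : cancel (actV X g) (actV X g^-1%g).
Proof. by move=> v; rewrite -actVM mulVg actV1. Qed.

Lemma actVKV g : cancel (actV X g^-1%g) (actV X g).
Proof. by move=> v; rewrite -actVM mulgV actV1. Qed.

Lemma actEK g : cancel (actE X g) (actE X g^-1%g).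
Proof. by move=> e; rewrite -actEM mulVg actE1. Qed.

Lemma actEKV g : cancel (actE X g^-1%g) (actE X g).
Proof. by move=> e; rewrite -actEM mulgV actE1. Qed.

Lemma cocV g e : coc X g^-1%g (actE X g e) = (coc X g e)^-1%g.
Proof.
apply: (@mulIg _ (coc X g e)).
by rewrite -cocM !mulVg coc1.
Qed.

Lemma act_path1 p : act_path X 1%g p = p.
Proof. by elim: p => //= e p IH; rewrite actE1 coc1 IH. Qed.

Lemma coc_path1 p : coc_path X 1%g p = 1%g.
Proof. by elim: p => //= e p IH; rewrite /coc_path /= coc1. Qed.

Lemma act_pathM g h p :
  act_path X (g * h)%g p = act_path X g (act_path X h p).
Proof.
by elim: p g h => //= e p IH g h; rewrite actEM cocM IH.
Qed.

Lemma coc_pathM g h p :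
  coc_path X (g * h)%g p = (coc_path X g (act_path X h p) * coc_path X h p)%g.
Proof.
rewrite /coc_path; elim: p g h => //= e p IH g h; by rewrite cocM IH.
Qed.

Lemma act_pathK g : cancel (act_path X g) (act_path X g^-1%g).
Proof. by move=> p; rewrite -act_pathM mulVg act_path1. Qed.

Lemma act_pathKV g : cancel (act_path X g^-1%g) (act_path X g).
Proof. by move=> p; rewrite -act_pathM mulgV act_path1. Qed.

Lemma size_act_path g p : size (act_path X g p) = size p.
Proof. by elim: p g => //= e p IH g; rewrite IH. Qed.

Lemma act_path_cat g p q :
  act_path X g (p ++ q) = act_path X g p ++ act_path X (coc_path X g p) q.
Proof. by elim: p g => //= e p IH g; rewrite IH. Qed.

Lemma coc_path_cat g p q :
  coc_path X g (p ++ q) = coc_path X (coc_path X g p) q.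
Proof. exact: foldl_cat. Qed.

Lemma is_path_cat v p q :
  is_path v (p ++ q) = is_path v p && is_path (path_src v p) q.
Proof. by elim: p v => //= e p IH v; rewrite IH andbA. Qed.

Lemma path_src_cat v p q : path_src v (p ++ q) = path_src (path_src v p) q.
Proof. by rewrite /path_src map_cat last_cat. Qed.

Lemma is_path_rcons v p e :
  is_path v (rcons p e) = is_path v p && (rng e == path_src v p).
Proof. by rewrite -cats1 is_path_cat /= andbT. Qed.

Lemma path_src_rcons v p e : path_src v (rcons p e) = src e.
Proof. by rewrite -cats1 path_src_cat. Qed.

Lemma path_edge_src v p e : is_path v p -> e \in p ->
  src e = path_src v p \/ exists2 f, f \in p & rng f = src e.
Proof.
move=> + ep; case/splitPr: ep => p1 p2; rewrite is_path_cat path_src_cat /=.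
case: p2 => [|f p2] /= => [_|/and4P[_ _ /eqP fe _]]; first by left.
by right; exists f; rewrite // mem_cat !inE eqxx !orbT.
Qed.

Lemma strongly_fixed_cat g v p q :
  strongly_fixed X g v p -> strongly_fixed X g v (p ++ q).
Proof.
case=> gv gp cp; split=> //; first by rewrite act_path_cat gp cp act_path1.
by rewrite coc_path_cat cp coc_path1.
Qed.

Lemma strongly_fixed_prefix g v p q :
  prefix p q -> strongly_fixed X g v p -> strongly_fixed X g v q.
Proof. by case/prefixP => q' ->; exact: strongly_fixed_cat. Qed.

(** Induction on the length: if [p] is not minimal, some proper prefix is strongly fixed, and it is
    strictly shorter. *)
Lemma minimal_prefix g v p : strongly_fixed X g v p ->
  exists2 q, prefix q p & minimal_strongly_fixed X g v q.
Proof.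
have [n] := ubnP (size p); elim: n p => // n IH p lepn sfp.
have [min|/existsNP[q /not_implyP[qp /not_implyP[neq /contrapT sfq]]]] :=
    pselect (forall q, prefix q p -> q != p -> ~ strongly_fixed X g v q).
  by exists p => //; exact: prefix_refl.
have ltqp : (size q < size p)%N.
  rewrite ltn_neqAle size_prefix // andbT; apply: contraNneq neq => eqs.
  by case/prefixP: qp eqs => r ->; rewrite size_cat => /eqP;
     rewrite -[X in X == _]addn0 eqn_add2l eq_sym => /nilP ->; rewrite cats0.
have [r rq rmin] := IH q (leq_trans ltqp lepn) sfq.
by exists r => //; exact: prefix_trans rq qp.
Qed.

Lemma is_path_prefix v p q : prefix p q -> is_path v q -> is_path v p.
Proof. by case/prefixP => r ->; rewrite is_path_cat => /andP[]. Qed.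

(* The algebraic form of Hausdorffness of the groupoid of germs. *)
Lemma strongly_fixed_bounded g v :
  finitely_many_minimal_strongly_fixed X ->
  exists N, forall p q, is_path v (p ++ q) -> (N <= size p)%N ->
    strongly_fixed X g v (p ++ q) -> strongly_fixed X g v p.
Proof.
move=> /(_ g v) /finite_seqP[s sE].
(* The bound is the greatest length of a minimal strongly fixed path. The minimal prefix [r] of
   [p ++ q] is then no longer than [p], hence already a prefix of [p]. *)
exists (\max_(q <- s) size q) => p q pq lep sfpq.
have [r rpq rmin] := minimal_prefix sfpq.
have rs : r \in s.
  have : [set` s]%classic r by rewrite -sE; split=> //; exact: is_path_prefix pq.
  by [].
have ler : (size r <= size p)%N.
  by apply: leq_trans lep; rewrite (big_rem _ rs) /= leq_max leqnn.
apply: strongly_fixed_prefix rmin.1.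
by move: rpq; rewrite !prefixE takel_cat.
Qed.

Lemma exists_edge v : exists e, rng e = v.
Proof. by have [e] := ss_no_sources X v; exists e. Qed.

(** A choice function picks at each vertex of [Y] an edge whose source stays in [Y]; iterating it
    from [v] gives the path. *)
Lemma exists_infpath v (Y : vert E -> Prop) : Y v ->
    (forall u, Y u -> exists2 e, rng e = u & Y (src e)) ->
  exists x, [/\ is_infpath x, rng (x 0%N) = v & forall n, Y (rng (x n))].
Proof.
move=> Yv step.
(* [e0] is only the default value of the choice function outside [Y]. *)
have [e0 _] := exists_edge v.
have [f fP] : {f : vert E -> edge E &
    forall u, Y u -> rng (f u) = u /\ Y (src (f u))}.
  apply: (@choice _ _ (fun u e => Y u -> rng e = u /\ Y (src e))) => u.
  have [Yu|nYu] := pselect (Y u); last by exists e0.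
  by have [e eu Ye] := step _ Yu; exists e.
pose y := fix y n := if n is m.+1 then f (src (y m)) else f v.
have yY n : Y (rng (y n)) /\ Y (src (y n)).
  elim: n => [|n [_ IH]] /=.
    by have [-> ?] := fP _ Yv.
  by have [-> ?] := fP _ IH.
exists y; split=> [n||n]; last by case: (yY n).
  by have [_ Yn] := yY n; rewrite /= (fP _ Yn).1.
by rewrite /= (fP _ Yv).1.
Qed.

Lemma exists_path_ext v n : exists2 p, is_path v p & size p = n.
Proof.
elim: n => [|n [p vp sp]]; first by exists [::].
have [e ep] := exists_edge (path_src v p).
by exists (rcons p e); rewrite ?size_rcons ?sp // is_path_rcons vp ep /=.
Qed.

Lemma is_path_mkseq (x : nat -> edge E) n :
  is_infpath x -> is_path (rng (x 0%N)) (mkseq x n) /\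
  path_src (rng (x 0%N)) (mkseq x n) = rng (x n).
Proof.
move=> xx; elim: n => // n [IH1 IH2].
by rewrite mkseqS is_path_rcons IH1 IH2 eqxx path_src_rcons xx.
Qed.

End SelfSimilarPaths.

(** * Monomials in a (G,E)-family *)

Section StarAlgebraTheory.
Variables (R : comPzRingType) (conj : R -> R) (A : starAlgebra conj).
Implicit Types a b c : A.

Lemma amul0r a : 0 ** a = 0.
Proof. by apply: (addrI (0 ** a)); rewrite -amulDl !addr0. Qed.

Lemma amulr0 a : a ** 0 = 0.
Proof. by apply: (addrI (a ** 0)); rewrite -amulDr !addr0. Qed.

Lemma amul_suml I (r : seq I) (Q : pred I) (F : I -> A) b :
  (\sum_(i <- r | Q i) F i) ** b = \sum_(i <- r | Q i) F i ** b.
Proof.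
by rewrite (big_morph (fun a => a ** b) (fun x y => amulDl x y b) (amul0r b)).
Qed.

Lemma amul_sumr I (r : seq I) (Q : pred I) (F : I -> A) b :
  b ** (\sum_(i <- r | Q i) F i) = \sum_(i <- r | Q i) b ** F i.
Proof. by rewrite (big_morph (amul b) (amulDr b) (amulr0 b)). Qed.


End StarAlgebraTheory.
Section Monomials.
Variables (R : comPzRingType) (conj : R -> R).
Variables (G : groupType) (E : graph) (X : self_similar_triple G E).
Variables (A : starAlgebra conj) (P : vert E -> G -> A) (S : edge E -> G -> A).
Hypothesis PS : GE_family X P S.
Implicit Types (g h : G) (v w : vert E) (e : edge E) (p q : seq (edge E)).
Implicit Types (a b c : A).

Let s e : A := S e 1%g.

(* [pmul p a] is [s_p a]; [mulp a p] is [a s_p]; [starp p a] is [s_p^* a]. *)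
Definition pmul p a : A := foldr (fun e b => s e ** b) a p.
Definition mulp a p : A := foldl (fun b e => b ** s e) a p.
Definition starp p a : A := foldl (fun b e => (s e)^† ** b) a p.
(* The element [s_p u_g] with source [w]; it vanishes unless [p] is a path
   with source [g . w]. *)
Definition mono p g w : A := pmul p (P (actV X g w) g).

Lemma pmulM p a b : pmul p a ** b = pmul p (a ** b).
Proof. by elim: p => //= e p <-; rewrite amulA. Qed.

Lemma pmul0 p : pmul p 0 = 0.
Proof. by elim: p => //= e p ->; rewrite amulr0. Qed.

Lemma mulpM a b p : a ** mulp b p = mulp (a ** b) p.
Proof. by elim: p b => //= e p IH b; rewrite IH amulA. Qed.

Lemma mulp0 p : mulp 0 p = 0.
Proof. by elim: p => //= e p IH; rewrite amul0r. Qed.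

Lemma mulpD p : {morph mulp^~ p : a b / a + b}.
Proof. by elim: p => //= e p IH a b; rewrite amulDl IH. Qed.

Lemma mulpZ p r a : mulp (r *: a) p = r *: mulp a p.
Proof. by elim: p a => //= e p IH a; rewrite -ascalerAl IH. Qed.

Lemma starp0 p : starp p 0 = 0.
Proof. by elim: p => //= e p IH; rewrite amulr0. Qed.

Lemma starpD p : {morph starp p : a b / a + b}.
Proof. by elim: p => //= e p IH a b; rewrite /= amulDr IH. Qed.

Lemma starpZ p r a : starp p (r *: a) = r *: starp p a.
Proof. by elim: p a => //= e p IH a; rewrite -ascalerAr IH. Qed.

Lemma S_split e g : S e g = s e ** P (src e) g.
Proof. by rewrite /s (gef_SP PS) actV1 eqxx mul1g. Qed.

Lemma star_s e f : (s e)^† ** s f = if e == f then P (src e) 1%g else 0.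
Proof. exact: (ef_starS (gef_E PS)). Qed.

Lemma P1 v : P v 1%g ** P v 1%g = P v 1%g.
Proof. by rewrite -(ef_proj (gef_E PS) v).2. Qed.

(** The vanishing alternative is kept so that nothing has to be assumed about [p], [v] or [f]. *)
Lemma mono_act v f p g w :
  P v f ** mono p g w = 0 \/
  P v f ** mono p g w = mono (act_path X f p) (coc_path X f p * g)%g w.
Proof.
elim: p v f => [|e p IH] v f; rewrite /mono /=.
  by rewrite (gef_PP PS) actVM; case: eqP => [->|_]; [right|left].
rewrite amulA (gef_PS PS); case: eqP => _; last by left; rewrite amul0r.
rewrite mulg1 S_split -amulA -!/(mono _ _ _).
by case: (IH (src (actE X f e)) (coc X f e)) => ->; [left; rewrite amulr0|right].
Qed.

Lemma mono_act1 v p g w : P v 1%g ** mono p g w = 0 \/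
  P v 1%g ** mono p g w = mono p g w.
Proof.
case: (mono_act v 1%g p g w) => ->; first by left.
by right; rewrite act_path1 coc_path1 mul1g.
Qed.

Lemma mono_nz v p g w : is_path v p -> path_src v p = actV X g w ->
  P v 1%g ** mono p g w = mono p g w.
Proof.
case: p => [_ |e p /andP[/eqP <- _] _].
  by rewrite /path_src /= => ->; rewrite /mono /= (gef_PP PS) actV1 eqxx mul1g.
by rewrite /mono /= amulA (gef_PS PS) actE1 coc1 mulg1 eqxx.
Qed.

(* When [p] is empty no condition is imposed on [g]. *)
Definition valid p g w := exists2 v, is_path v p & path_src v p = actV X g w.

Lemma mono_valid p g w : mono p g w != 0 -> valid p g w.
Proof.
(* Multiplying by [P v 1] tells the induction at which vertex the path has its range. *)
suff H v : P v 1%g ** mono p g w != 0 ->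
    is_path v p /\ path_src v p = actV X g w.
  case: p H => [|e p] H; first by exists (actV X g w).
  move=> nz; exists (rng e).
    by apply: (proj1 (H _ _)); rewrite /mono /= amulA (gef_PS PS) actE1 coc1 mulg1 eqxx.
  by apply: (proj2 (H _ _)); rewrite /mono /= amulA (gef_PS PS) actE1 coc1 mulg1 eqxx.
elim: p v => [|e p IH] v; rewrite /mono /=.
  by rewrite (gef_PP PS) actV1 mul1g; case: (v =P _) => [->|]; rewrite ?eqxx.
rewrite amulA (gef_PS PS) actE1 coc1 mulg1; case: (v =P _) => [->|_].
  rewrite S_split -amulA eqxx => nz.
  have [|-> srcp] := IH (src e).
    by apply: contraNneq nz; rewrite -/(mono _ _ _) => ->; rewrite amulr0.
  by split.
by rewrite amul0r eqxx.
Qed.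

Lemma mono_mulr p h u g w : mono p h u ** mono [::] g w =
  if u == actV X g w then mono p (h * g)%g w else 0.
Proof.
rewrite /mono pmulM /= (gef_PP PS) (inj_eq (can_inj (actVK _ _))).
by case: eqP => [->|_]; rewrite ?actVM // pmul0.
Qed.

Lemma mono_s p g w e : rng e = w ->
  mono p g w ** s e = mono (rcons p (actE X g e)) (coc X g e) (src e).
Proof.
move=> rew; rewrite /mono pmulM (gef_PS PS) act_rng rew eqxx mulg1 S_split.
by rewrite act_src coc_actV /pmul foldr_rcons.
Qed.

Lemma mulp_mono p g w q : is_path w q -> mulp (mono p g w) q =
  mono (p ++ act_path X g q) (coc_path X g q) (path_src w q).
Proof.
elim: q p g w => [|e q IH] p g w /=; first by rewrite cats0.
by case/andP=> /eqP rew eq; rewrite mono_s // IH // cat_rcons.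
Qed.

Lemma mono1_mulp v p : is_path v p -> mulp (mono [::] 1%g v) p = mono p 1%g (path_src v p).
Proof. by move=> vp; rewrite mulp_mono // act_path1 coc_path1. Qed.

Lemma starp_keep v p g w : is_path v p -> path_src v p = actV X g w ->
  starp p (mono p g w) = mono [::] g w.
Proof.
elim: p v => //= e p IH v /andP[_ ep] srcp.
rewrite {1}/mono /= amulA star_s eqxx -/(mono p g w) (@mono_nz (src e)) //.
exact: IH srcp.
Qed.

(** As [p] is not longer than [q], the two disagree at some edge before [q] is used up, and there
    [s_e^* s_f = 0] with [e] different from [f]. *)
Lemma starp_kill p q g w : ~~ prefix p q -> (size p <= size q)%N ->
  starp p (mono q g w) = 0.
Proof.
elim: p q => [q|e p IH [|f q] //= npq lepq]; first by rewrite prefix0s.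
rewrite /mono /= amulA star_s; move: npq.
case: (e =P f) => [_ npq|_ _]; last by rewrite amul0r starp0.
rewrite -/(mono _ _ _).
by case: (mono_act1 (src e) q g w) => ->; rewrite ?starp0 ?IH.
Qed.

(** [P v 1] is the sum of the [s_e s_e^*] over the edges [e] into [v], so if every [a s_e] vanished
    then so would [a ** P v 1]. *)
Lemma exists_mul_s a v : a ** P v 1%g != 0 ->
  exists2 e, rng e = v & a ** s e != 0.
Proof.
move=> nz; apply: contrapT => none; move/eqP: nz; apply.
have fin := ss_row_finite X v.
rewrite (ef_sum (gef_E PS)) fsbig_finite //= amul_sumr big_seq big1 // => e.
rewrite in_fset_set // inE /= => rev; rewrite amulA.
case: (eqVneq (a ** s e) 0) => [->|nz]; first by rewrite amul0r.
by case: none; exists e.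
Qed.

Lemma exists_mulp a v n : a ** P v 1%g != 0 ->
  exists p, [/\ is_path v p, size p = n & mulp (a ** P v 1%g) p != 0].
Proof.
move=> nz; elim: n => [|n [p [vp sp nzp]]]; first by exists [::].
have pE : mulp (a ** P v 1%g) p ** P (path_src v p) 1%g
    = mulp (a ** P v 1%g) p.
  have -> : P v 1%g = mono [::] 1%g v by rewrite /mono /= actV1.
  rewrite -!mulpM mono1_mulp // -amulA.
  have -> : P (path_src v p) 1%g = mono [::] 1%g (path_src v p) by rewrite /mono /= actV1.
  by rewrite mono_mulr actV1 eqxx mulg1.
have [|e ep nze] := @exists_mul_s (mulp (a ** P v 1%g) p) (path_src v p).
  by rewrite pE.
exists (rcons p e); rewrite is_path_rcons vp ep eqxx size_rcons sp.
by rewrite /mulp foldl_rcons.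
Qed.

(** * Combinations of monomials, and the elements that produce them *)

(** Lists, in which entries may repeat or vanish: the number of terms to be minimized is then just a
    length. *)
Definition coefs := seq (R * (seq (edge E) * G)).

Definition elem w (l : coefs) : A := \sum_(x <- l) x.1 *: mono x.2.1 x.2.2 w.

Lemma elem_cons w x l : elem w (x :: l) = x.1 *: mono x.2.1 x.2.2 w + elem w l.
Proof. exact: big_cons. Qed.

Lemma elem_cat w l1 l2 : elem w (l1 ++ l2) = elem w l1 + elem w l2.
Proof. exact: big_cat. Qed.

Lemma elem_nil w : elem w [::] = 0.
Proof. exact: big_nil. Qed.

Lemma elem_perm w l1 l2 : perm_eq l1 l2 -> elem w l1 = elem w l2.
Proof. exact: perm_big. Qed.

(** The effect of right multiplication by [s_q] on one entry: [u_g s_q] is [s_(g . q)] times [u] of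
    the restriction of [g] to [q]. *)
Definition ext q (x : R * (seq (edge E) * G)) :=
  (x.1, (x.2.1 ++ act_path X x.2.2 q, coc_path X x.2.2 q)).

Lemma mulp_elem w q l : is_path w q ->
  mulp (elem w l) q = elem (path_src w q) (map (ext q) l).
Proof.
move=> wq; elim: l => [|x l IH] /=; first by rewrite !elem_nil mulp0.
by rewrite !elem_cons mulpD mulpZ mulp_mono // IH.
Qed.

Lemma elem_P w l : elem w l ** P w 1%g = elem w l.
Proof.
rewrite /elem amul_suml; apply: eq_bigr => x _; rewrite -ascalerAl.
have := mono_mulr x.2.1 x.2.2 w 1%g w.
by rewrite actV1 eqxx mulg1 {2}/mono /= actV1 => ->.
Qed.

(** On long monomials all the adjoints occurring in [a] get absorbed. The second clause says that at
    most [N] edges are lost; it is what makes products of tame elements tame. *)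
Definition tame a := exists N, forall p g w, (N <= size p)%N ->
  exists2 l : coefs, a ** mono p g w = elem w l &
    {in l, forall x, (size p <= size x.2.1 + N)%N}.

Lemma tame_mono_case a N : (forall p g w, (N <= size p)%N ->
    a ** mono p g w = 0 \/ exists q h,
      a ** mono p g w = mono q h w /\ (size p <= size q + N)%N) -> tame a.
Proof.
move=> H; exists N => p g w lep; have [->|[q [h [-> leq]]]] := H p g w lep.
  by exists [::]; rewrite ?elem_nil.
exists [:: (1, (q, h))]; first by rewrite elem_cons elem_nil addr0 scale1r.
by move=> x; rewrite inE => /eqP ->.
Qed.

Lemma tame_P v f : tame (P v f).
Proof.
apply: (@tame_mono_case _ 0%N) => p g w _.
case: (mono_act v f p g w) => ->; [by left|right].
by exists (act_path X f p), (coc_path X f p * g)%g; rewrite size_act_path addn0.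
Qed.

Lemma tame_S e f : tame (S e f).
Proof.
apply: (@tame_mono_case _ 0%N) => p g w _; rewrite S_split -amulA.
case: (mono_act (src e) f p g w) => ->; [by left; rewrite amulr0|right].
exists (e :: act_path X f p), (coc_path X f p * g)%g.
by rewrite /= size_act_path addn0.
Qed.

(** The adjoint consumes exactly one edge, hence the constant 1. *)
Lemma tame_starS e f : tame (S e f)^†.
Proof.
apply: (@tame_mono_case _ 1%N) => -[|e' p] g w // _.
rewrite S_split astarM -amulA {1}/mono /= -/(mono p g w) (amulA (s e)^†).
rewrite star_s; case: eqP => _; last by left; rewrite !(amulr0, amul0r).
rewrite amulA (gef_starP PS) (gef_PP PS); case: eqP => _; last by left; rewrite amul0r.
set v := actV X _ _; case: (mono_act v (f^-1 * 1)%g p g w) => ->; [by left|right].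
exists (act_path X (f^-1 * 1)%g p), (coc_path X (f^-1 * 1)%g p * g)%g.
by rewrite size_act_path addn1.
Qed.

Lemma tame0 : tame 0.
Proof. by apply: (@tame_mono_case _ 0%N) => *; left; rewrite amul0r. Qed.

Lemma tameD a b : tame a -> tame b -> tame (a + b).
Proof.
case=> N1 H1 [N2 H2]; exists (maxn N1 N2) => p g w; rewrite geq_max => /andP[le1 le2].
have [l1 E1 L1] := H1 p g w le1; have [l2 E2 L2] := H2 p g w le2.
exists (l1 ++ l2); first by rewrite amulDl E1 E2 elem_cat.
move=> x; rewrite mem_cat => /orP[/L1|/L2] le; apply: leq_trans le _;
by rewrite leq_add2l ?leq_maxl ?leq_maxr.
Qed.

Lemma elemZ r w (l : coefs) :
  r *: elem w l = elem w [seq (r * x.1, x.2) | x <- l].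
Proof.
elim: l => [|x l IH]; rewrite /= ?elem_nil ?scaler0 // !elem_cons scalerDr IH.
by rewrite scalerA.
Qed.

Lemma tameZ r a : tame a -> tame (r *: a).
Proof.
case=> N H; exists N => p g w lep; have [l El Ll] := H p g w lep.
exists [seq (r * x.1, x.2) | x <- l]; first by rewrite -ascalerAl El elemZ.
by move=> _ /mapP[x /Ll lx ->].
Qed.

(** After [b] has removed at most [N2] edges from a path of length at least [N1 + N2], the remaining
    paths are still long enough for [a]. *)
Lemma tameM a b : tame a -> tame b -> tame (a ** b).
Proof.
case=> N1 H1 [N2 H2]; exists (N1 + N2)%N => p g w le12.
have [|l2 E2 L2] := H2 p g w; first exact: leq_trans (leq_addl _ _) le12.
rewrite -amulA E2; elim: l2 L2 {E2} => [|x l2 IH] L2.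
  by exists [::]; rewrite ?elem_nil ?amulr0.
have [|l' El' L'] := IH; first by move=> y yl; apply: L2; rewrite inE yl orbT.
have lex : (size p <= size x.2.1 + N2)%N by apply: L2; rewrite inE eqxx.
have [|l1 E1 L1] := H1 x.2.1 x.2.2 w.
  by rewrite -(leq_add2r N2) (leq_trans le12 lex).
exists ([seq (x.1 * y.1, y.2) | y <- l1] ++ l').
  by rewrite elem_cons amulDr -ascalerAr E1 elem_cat elemZ El'.
move=> y; rewrite mem_cat => /orP[/mapP[z /L1 lez ->]|/L' //] /=.
by rewrite addnA; apply: leq_trans lex _; rewrite leq_add2r.
Qed.

(** * Local units *)

Definition vsum (F : seq (vert E)) : A := \sum_(v <- undup F) P v 1%g.

Lemma vsum_P F v : v \in F -> P v 1%g ** vsum F = P v 1%g.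
Proof.
move=> vF; rewrite /vsum amul_sumr (bigD1_seq v) ?mem_undup ?undup_uniq //= P1.
rewrite big1 ?addr0 // => w /eqP wv; apply: (ef_orth (gef_E PS)) => vw.
exact/wv/esym.
Qed.

Lemma vsum_sub F F' : {subset F <= F'} -> vsum F ** vsum F' = vsum F.
Proof.
move=> sub; rewrite {1}/vsum amul_suml; apply: eq_big_seq => v.
by rewrite mem_undup => /sub; exact: vsum_P.
Qed.

(** Finite sums of vertex projections replace the unit that the algebra may lack. *)
Definition runital a := exists F, a ** vsum F = a.

Lemma runitalD a b : runital a -> runital b -> runital (a + b).
Proof.
case=> F1 H1 [F2 H2]; exists (F1 ++ F2); rewrite amulDl -{1}H1 -{1}H2 -!amulA.
by rewrite !vsum_sub ?H1 ?H2 // => v vF; rewrite mem_cat vF ?orbT.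
Qed.

Lemma runitalM a b : runital b -> runital (a ** b).
Proof. by case=> F H; exists F; rewrite -amulA H. Qed.

Lemma runitalZ r a : runital a -> runital (r *: a).
Proof. by case=> F H; exists F; rewrite -ascalerAl H. Qed.

Lemma runital_P v g : runital (P v g).
Proof.
exists [:: actV X g^-1%g v]; rewrite /vsum /= big_seq1 (gef_PP PS).
by rewrite actVKV eqxx mulg1.
Qed.

Lemma runital_S e g : runital (S e g).
Proof. by rewrite S_split; apply: runitalM; exact: runital_P. Qed.

Lemma runital_starS e g : runital (S e g)^†.
Proof.
rewrite S_split astarM.
have -> : s e = P (rng e) 1%g ** s e by rewrite (gef_PS PS) actE1 coc1 mulg1 eqxx.
by rewrite astarM !(gef_starP PS); do 2!apply: runitalM; exact: runital_P.
Qed.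

End Monomials.

(** * Ideals of L_R(G,E) *)

Section AvoidingPaths.
Variables (G : groupType) (E : graph) (X : self_similar_triple G E).
Implicit Types (g h : G) (v w : vert E) (e : edge E) (p q : seq (edge E)).

Lemma coc_pathV g p :
  coc_path X g^-1%g (act_path X g p) = (coc_path X g p)^-1%g.
Proof.
apply: (@mulIg _ (coc_path X g p)).
by rewrite -coc_pathM !mulVg coc_path1.
Qed.

(** The path has to be nonempty because the range of its first edge shows that [g^-1 * h] fixes
    [v]. *)
Lemma strongly_fixedP g h v p : p != [::] -> is_path v p ->
  act_path X g p = act_path X h p -> coc_path X g p = coc_path X h p ->
  strongly_fixed X (g^-1 * h)%g v p.
Proof.
move=> p0 vp gh cgh; split; last 2 first.
- by rewrite act_pathM -gh act_pathK.
- by rewrite coc_pathM -gh coc_pathV cgh mulVg.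
case: p p0 vp gh {cgh} => //= e p _ /andP[/eqP <- _] [gh _].
by rewrite actVM -act_rng -gh act_rng actVK.
Qed.

Lemma strongly_fixed_eq g h v p : strongly_fixed X (g^-1 * h)%g v p ->
  act_path X g p = act_path X h p /\ coc_path X g p = coc_path X h p.
Proof.
case=> _; rewrite act_pathM coc_pathM => fp cp.
have gh : act_path X g p = act_path X h p by rewrite -{1}fp act_pathKV.
split=> //; apply: invg_inj; rewrite -coc_pathV gh.
by apply/eqP; rewrite -mulg_eq1 cp.
Qed.

Lemma prefix_cat_size p p' q q' : (size p <= size q)%N ->
  prefix (p ++ p') (q ++ q') -> prefix p q.
Proof.
move=> lepq /prefixP[r]; rewrite -catA => /(congr1 (take (size p))).
rewrite (takel_cat _ lepq) take_size_cat // => pE.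
by rewrite prefixE pE.
Qed.

Lemma valid_ext p g w q : valid X p g w -> is_path w q ->
  valid X (p ++ act_path X g q) (coc_path X g q) (path_src w q).
Proof.
case=> v vp srcp wq; exists v.
  by rewrite is_path_cat vp srcp is_path_act.
by rewrite path_src_cat srcp path_src_act coc_path_actV.
Qed.

(** The monomials given by [x] and [y] remain formally distinct after right multiplication by any
    [s_q]. *)
Definition separated w (x y : seq (edge E) * G) :=
  forall q, is_path w q ->
  ~ (x.1 ++ act_path X x.2 q = y.1 ++ act_path X y.2 q /\
     coc_path X x.2 q = coc_path X y.2 q).

Hypothesis circuit_entry :
  forall g v p, G_circuit X g v p -> has_entry p.
Hypothesis cylinder_slack : forall v g, fixes_cylinder X g v -> slack X g v.

(** Only [q = p ++ c] is a problem. If [c] is empty, separation and condition (3) yield a path on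
    which [g] and [h] differ. Otherwise [c] is a [G]-circuit, unless it starts away from [g . w],
    and a path that leaves it at an entry serves. *)
Lemma avoid_one w p g q h : (size p <= size q)%N -> valid X q h w ->
    separated w (p, g) (q, h) ->
  exists2 r, is_path w r &
    ~~ prefix (p ++ act_path X g r) (q ++ act_path X h r).
Proof.
move=> lepq [v vq srcq] sep.
have [pq|npq] := boolP (prefix p q); last first.
  by exists [::]; rewrite //= !cats0.
case/prefixP: pq => c qE; subst q.
suff [r wr npr] : exists2 r, is_path w r &
    ~~ prefix (act_path X g r) (c ++ act_path X h r).
  by exists r => //; rewrite -catA prefix_catr ?eqxx.
have [e0 e0w] := exists_edge X w.
case: c => [|f c] in vq srcq sep {lepq} *.
  rewrite cats0 in sep.
  have [ghw|ghw] := eqVneq (actV X g w) (actV X h w); last first.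
    exists [:: e0]; rewrite /= ?e0w ?eqxx // andbT.
    by apply: contraNneq ghw => /(congr1 (@rng E)); rewrite !act_rng e0w => ->.
  (* If [g^-1 * h] fixed all infinite paths at [w], it would be slack there, so [g] and [h] would
     agree on some path [r] together with their restrictions, against separation. *)
  have [x [xx xw [n xn]]] : exists x, [/\ is_infpath x, rng (x 0%N) = w &
      exists n, act_inf X (g^-1 * h)%g x n <> x n].
    apply: contrapT => none; have [n sl] : slack X (g^-1 * h)%g w.
      apply: cylinder_slack => x xx xw; apply: funext => n.
      by apply: contrapT => xn; apply: none; exists x; split=> //; exists n.
    have [r wr nr] := exists_path_ext X w n.
    have [|E1 E2] := @strongly_fixed_eq g h w r; first by apply: sl; rewrite ?nr.
    by apply: (sep r) => //=; rewrite E1 E2.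
  exists (mkseq x n.+1); first by rewrite -xw; case: (is_path_mkseq n.+1 xx).
  rewrite cat0s prefixE size_act_path -{1}(size_act_path X h) take_size.
  apply/eqP => ghx; apply: xn.
  have := act_pathK X g (mkseq x n.+1).
  rewrite -ghx -act_pathM -act_inf_prefix => /(congr1 (fun s => nth (x n) s n)).
  by rewrite !nth_mkseq.
move: vq; rewrite is_path_cat /= => /and3P[vp /eqP fp fc].
have [gw|gw] := eqVneq (rng f) (actV X g w); last first.
  exists [:: e0]; rewrite /= ?e0w ?eqxx //.
  by apply: contraNN gw => /andP[/eqP <- _]; rewrite act_rng e0w.
(* The remainder runs from [g . w] to [h . w], which is the image of [g . w] under [h * g^-1]. *)
have circ : G_circuit X (h * g^-1)%g (actV X g w) (f :: c).
  split=> //=; first by rewrite gw eqxx.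
  by rewrite actVM actVK -srcq path_src_cat.
have [e ec [f1 [f2 [f12 f1e f2e]]]] := circuit_entry circ.
suff [r gr npr] : exists2 r, is_path (actV X g w) r & forall s, ~~ prefix r ((f :: c) ++ s).
  exists (act_path X g^-1%g r); last by rewrite act_pathKV; exact: npr.
  by rewrite -[w](actVK X g); exact: is_path_act.
have [d [de dE]] : exists d, d <> e /\ rng d = rng e.
  have [f1E|] := pselect (f1 = e); last by exists f1.
  by exists f2; split=> // f2E; apply: f12; rewrite f1E f2E.
case: circ => fc' _ _; case/splitPr: ec fc' => c1 c2.
rewrite is_path_cat /= => /and3P[gc1 /eqP ec1 _].
(* Follow the circuit up to the entry, then take the other edge [d]. *)
exists (rcons c1 d); first by rewrite is_path_rcons gc1 dE ec1 eqxx.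
move=> s; rewrite -cats1 -catA prefix_catr // eqxx /= negb_and.
by apply/orP; left; apply/eqP.
Qed.

(** The path is lengthened once per entry of [l]. Entries already excluded stay excluded, since a
    prefix relation between the extensions would restrict to one between the shorter paths. *)
Lemma avoid_all w x (l : seq (seq (edge E) * G)) :
    {in l, forall y, [/\ (size x.1 <= size y.1)%N, valid X y.1 y.2 w &
                         separated w x y]} ->
  exists2 r, is_path w r & {in l, forall y,
    ~~ prefix (x.1 ++ act_path X x.2 r) (y.1 ++ act_path X y.2 r)}.
Proof.
elim: l => [|y l IH] Hl; first by exists [::].
have [|r wr Hr] := IH; first by move=> z zl; apply: Hl; rewrite inE zl orbT.
have [lexy vy sep] := Hl y (mem_head _ _).
have [|||t rt Ht] := @avoid_one (path_src w r)
  (x.1 ++ act_path X x.2 r) (coc_path X x.2 r)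
  (y.1 ++ act_path X y.2 r) (coc_path X y.2 r).
- by rewrite !size_cat !size_act_path leq_add2r.
- exact: valid_ext.
- move=> t rt; rewrite /= -!catA -!act_path_cat -!coc_path_cat; apply: sep.
  by rewrite is_path_cat wr.
exists (r ++ t); first by rewrite is_path_cat wr.
move=> z; rewrite inE !act_path_cat !catA => /orP[/eqP ->//|zl].
apply: contraNN (Hr z zl); apply: prefix_cat_size.
have [|lexz _ _] := Hl z; first by rewrite inE zl orbT.
by rewrite !size_cat !size_act_path leq_add2r.
Qed.

End AvoidingPaths.

(** * From a nonzero element of an ideal to all vertex projections *)

Section IdealVertex.
Variables (R : comPzRingType) (conj : R -> R).
Variables (G : groupType) (E : graph) (X : self_similar_triple G E).
Variables (A : starAlgebra conj) (P : vert E -> G -> A) (S : edge E -> G -> A).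
Hypothesis PS : GE_family X P S.
Variable I : set A.
Hypothesis idI : two_sided_ideal (@amul R conj A) I.

Lemma ideal_mulp a p : I a -> I (mulp S a p).
Proof.
by case: idI => _ _ _ Ir; elim: p a => //= e p IH a Ia; exact/IH/Ir.
Qed.

Lemma ideal_starp a p : I a -> I (starp S p a).
Proof.
by case: idI => _ _ Il _; elim: p a => //= e p IH a Ia; exact/IH/Il.
Qed.

(* Two entries with the same monomial could be merged, and a vanishing one
   dropped. *)
Lemma shortest_combination n u l x l' :
    (forall u l, I (elem X P S u l) -> elem X P S u l != 0 -> (n <= size l)%N) ->
    perm_eq l (x :: l') -> size l = n ->
    I (elem X P S u l) -> elem X P S u l != 0 ->
  [/\ x.1 != 0, valid X x.2.1 x.2.2 u & {in l', forall y, y.2 <> x.2}].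
Proof.
move=> Hmin lE sl Il nzl; have slE : size l = (size l').+1 by rewrite (perm_size lE).
have lEl := elem_perm X P S u lE.
have xnz : x.1 *: mono X P S x.2.1 x.2.2 u != 0.
  apply: contraTneq isT => x0; rewrite elem_cons x0 add0r in lEl.
  by have := Hmin u l'; rewrite -lEl -sl slE ltnn; apply.
split.
- by apply: contraNneq xnz => ->; rewrite scale0r.
- by apply: (mono_valid PS); apply: contraNneq xnz => ->; rewrite scaler0.
move=> y yl' yx; have yE := perm_to_rem yl'.
have := Hmin u ((x.1 + y.1, x.2) :: rem y l').
suff -> : elem X P S u ((x.1 + y.1, x.2) :: rem y l') = elem X P S u l.
  move=> /(_ Il nzl); rewrite -sl slE (perm_size yE) /= ltnn; exact.
rewrite lEl !elem_cons (elem_perm X P S u yE) elem_cons /= scalerDl addrA.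
by rewrite yx.
Qed.

Lemma exists_shortest (T : eqType) (f : T -> nat) (l : seq T) : l != [::] ->
  exists2 x, x \in l & {in l, forall y, (f x <= f y)%N}.
Proof.
elim: l => // x [|y l] IH _.
  by exists x; rewrite ?mem_head // => z; rewrite inE => /eqP ->.
have [//|z zl Hz] := IH.
have [lezx|/ltnW lexz] := leqP (f z) (f x).
  exists z; first by rewrite inE zl orbT.
  by move=> t; rewrite inE => /predU1P[->//|/Hz].
exists x; rewrite ?mem_head // => t; rewrite inE => /predU1P[->//|/Hz].
exact: leq_trans.
Qed.

Hypothesis Hfin : finitely_many_minimal_strongly_fixed X.
Hypothesis circuit_entry :
  forall g v p, G_circuit X g v p -> has_entry p.
Hypothesis cylinder_slack : forall v g, fixes_cylinder X g v -> slack X g v.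
Hypothesis R_inv : forall c : R, c != 0 -> exists d, d * c = 1.

(* In a shortest nonzero combination lying in [I], compare every entry with the
   one of least path length: they differ on every long enough path by
   minimality together with [Hfin], hence can be killed one by one with
   [avoid_all], leaving a nonzero multiple of some [P (actV X g w) g]. *)
Lemma ideal_combination_vertex u l : I (elem X P S u l) -> elem X P S u l != 0 ->
  exists w, I (P w 1%g).
Proof.
move=> Iul nzul; case: (idI) => [_ _ Il Ir].
pose Q n := `[< exists u l, [/\ size l = n, I (elem X P S u l) &
                                elem X P S u l != 0] >].
have exQ : exists n, Q n by exists (size l); apply/asboolP; exists u, l.
case: (ex_minnP exQ) => n /asboolP[{Iul nzul}u [{}l [sl Iul nzul]]] minQ.
have Hmin v k : I (elem X P S v k) -> elem X P S v k != 0 -> (n <= size k)%N.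
  by move=> Ik nzk; apply: minQ; apply/asboolP; exists v, k.
have [|x xl xmin] := @exists_shortest _ (fun x => size x.2.1) l.
  by apply: contraNneq nzul => ->; rewrite elem_nil.
have lE := perm_to_rem xl; set l' := rem x l in lE.
have l'l y : y \in l' -> y \in l by exact: mem_rem.
have [N HN] : exists N, {in l', forall y, forall p q, is_path u (p ++ q) ->
    (N <= size p)%N -> strongly_fixed X (x.2.2^-1 * y.2.2)%g u (p ++ q) ->
    strongly_fixed X (x.2.2^-1 * y.2.2)%g u p}.
  have [f fP] := choice (fun g => strongly_fixed_bounded g u Hfin).
  exists (\max_(y <- l') f (x.2.2^-1 * y.2.2)%g) => y yl' p q pq leN.
  by apply: fP pq _; apply: leq_trans leN; rewrite (big_rem _ yl') /= leq_max leqnn.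
(* Length [N.+1] rather than [N] makes [t ++ q] nonempty, as [strongly_fixedP] requires. *)
have [|t [ut st nzt]] := @exists_mulp _ _ _ _ X _ _ _ PS (elem X P S u l) u N.+1.
  by rewrite (elem_P PS).
rewrite (elem_P PS) (mulp_elem PS _ ut) in nzt.
have It : I (elem X P S (path_src u t) (map (ext X t) l)).
  by rewrite -(mulp_elem PS _ ut); exact: ideal_mulp.
(* Right multiplication keeps the number of entries, so [l2] is again a shortest nonzero combination
   in [I]. *)
set l2 := map _ l in nzt It; set u2 := path_src u t in nzt It.
have l2E : perm_eq l2 (ext X t x :: map (ext X t) l') by exact: (perm_map (ext X t) lE).
have sl2 : size l2 = n by rewrite size_map.
have [c0 vx dist] := shortest_combination Hmin l2E sl2 It nzt.
have Hl' : {in map snd (map (ext X t) l'), forall y : seq (edge E) * G,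
    [/\ (size (ext X t x).2.1 <= size y.1)%N, valid X y.1 y.2 u2 &
        separated X u2 (ext X t x).2 y]}.
  move=> _ /mapP[_ /mapP[y yl' ->] ->].
  have ley := xmin y (l'l y yl').
  split; first by rewrite !size_cat !size_act_path leq_add2r.
    have yl2 : ext X t y \in l2 by apply: map_f; exact: l'l.
    by have [] := shortest_combination Hmin (perm_to_rem yl2) sl2 It nzt.
  (* If the two entries agreed along [t ++ q], the quotient of their group elements would strongly
     fix [t ++ q], hence [t] by the choice of [N]. The entries of [l2] would then coincide, against
     [dist]. *)
  move=> q tq [/=]; rewrite -!catA -!act_path_cat -!coc_path_cat => E1 E2.
  have sxy : size x.2.1 = size y.2.1.
    by have /eqP := congr1 size E1; rewrite !size_cat !size_act_path eqn_add2r => /eqP.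
  move/eqP: E1; rewrite eqseq_cat // => /andP[/eqP xy /eqP E1].
  apply: (dist (ext X t y)); first exact: map_f.
  have utq : is_path u (t ++ q) by rewrite is_path_cat ut.
  have [|F1 F2] := @strongly_fixed_eq _ _ X x.2.2 y.2.2 u t.
    apply: (HN _ yl' t q utq); first by rewrite st.
    by apply: strongly_fixedP => //; rewrite -size_eq0 size_cat st.
  by rewrite /= F1 F2 xy.
have [r ur Hr] := avoid_all circuit_entry cylinder_slack Hl'.
pose p := (ext X t x).2.1 ++ act_path X (ext X t x).2.2 r.
pose g := coc_path X (ext X t x).2.2 r; pose w := path_src u2 r.
have [v vp srcp] := valid_ext vx ur.
have pE : starp S p (mulp S (elem X P S u2 l2) r) = x.1 *: P (actV X g w) g.
  rewrite (elem_perm _ _ _ _ l2E) (mulp_elem PS _ ur) /= elem_cons starpD starpZ.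
  rewrite (starp_keep PS vp srcp) [X in _ + X](_ : _ = 0) ?addr0 //.
  rewrite /elem (big_morph (starp S p) (starpD S p) (starp0 S p)) big_map.
  rewrite big_seq big1 // => y yl'; rewrite starpZ (starp_kill PS) ?scaler0 //.
    by apply: Hr; exact: map_f.
  have [+ _ _] := Hl' y.2 (map_f snd yl').
  by rewrite !size_cat !size_act_path leq_add2r.
have Ip : I (x.1 *: P (actV X g w) g).
  by rewrite -pE; apply/ideal_starp/ideal_mulp.
have [d dc] := R_inv c0.
exists w; have := Il (d *: P w g^-1%g) _ Ip.
rewrite -ascalerAl -ascalerAr scalerA dc scale1r (gef_PP PS) actVK eqxx.
by rewrite mulVg.
Qed.

(** A local unit provides [v] with [a ** P v 1] nonzero; right multiplication by a suitable [s_p] of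
    length [N] keeps it nonzero and, by tameness, makes it a combination of monomials. *)
Lemma ideal_vertex a : tame X P S a -> runital P a -> I a -> a != 0 ->
  exists w, I (P w 1%g).
Proof.
move=> [N HN] [F aF] Ia nza; case: (idI) => [_ _ Il Ir].
have [v nzv] : exists v, a ** P v 1%g != 0.
  apply: contrapT => none; move/eqP: nza; apply; rewrite -aF /vsum amul_sumr.
  rewrite big1 // => v _; apply/eqP; apply: contraPT none => nz; apply; by exists v.
have [p [vp sp]] := exists_mulp PS N nzv.
have [|l lE _] := HN p 1%g (path_src v p); first by rewrite sp.
have -> : P v 1%g = mono X P S [::] 1%g v by rewrite /mono /= actV1.
rewrite -mulpM (mono1_mulp PS) // lE => nzl.
by apply: ideal_combination_vertex nzl; rewrite -lE; exact: Ir.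
Qed.

Hypothesis trans : weakly_G_transitive X.

(** [s_e^* p_(r e) s_e = p_(s e)]. *)
Lemma ideal_rng_src e : I (P (rng e) 1%g) -> I (P (src e) 1%g).
Proof.
case: (idI) => [_ _ Il Ir] Ie; have := Il (S e 1%g)^† _ (Ir (S e 1%g) _ Ie).
by rewrite (gef_PS PS) actE1 coc1 mulg1 eqxx (star_s PS) eqxx.
Qed.

Lemma ideal_path_src v p : is_path v p -> I (P v 1%g) -> I (P (path_src v p) 1%g).
Proof.
elim: p v => //= e p IH v /andP[/eqP <- ep] /ideal_rng_src; exact: IH.
Qed.

Lemma ideal_act g v : I (P (actV X g v) 1%g) -> I (P v 1%g).
Proof.
case: (idI) => [_ _ Il Ir] /(Il (P v g^-1%g)) /(Ir (P (actV X g v) g)).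
by do 2!rewrite (gef_PP PS) actVK eqxx ?mulg1; rewrite mulVg.
Qed.

Lemma ideal_sum (T : Type) (l : seq T) (Q : pred T) (F : T -> A) :
  (forall x, Q x -> I (F x)) -> I (\sum_(x <- l | Q x) F x).
Proof.
case: idI => [I0 IB _ _] IF; elim/big_rec: _ => // x a Qx Ia.
rewrite -[a]opprK; apply: (IB); first exact: IF.
by rewrite -sub0r; exact: IB.
Qed.

(** If [P v 1] is outside [I], then by the summation relation some edge into [v] has a source with
    the same property; this yields an infinite path of such vertices. Transitivity connects [u] to a
    translate of one of them, a contradiction. *)
Lemma ideal_all_vertices u : I (P u 1%g) -> forall v, I (P v 1%g).
Proof.
case: (idI) => [_ _ Il Ir] Iu v; apply: contrapT => nIv.
have [w nIw|x [xx _ nIx]] := @exists_infpath _ _ X v (fun w => ~ I (P w 1%g)) nIv.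
  apply: contrapT => none; apply: nIw.
  have fin := ss_row_finite X w.
  rewrite (ef_sum (gef_E PS)) fsbig_finite //= big_seq; apply: ideal_sum => e.
  rewrite in_fset_set // inE /= => ew.
  rewrite {1}(S_split PS e 1%g); apply/Ir/Il.
  by apply: contrapT => nIe; apply: none; exists e.
have [w [[i wE] [g [p [up srcp]]]]] := trans u xx.
have : I (P w 1%g) by apply: (@ideal_act g); rewrite -srcp; exact: ideal_path_src.
case: wE => ->; first exact: nIx.
by rewrite xx; exact: nIx.
Qed.

Lemma ideal_full a : runital P a -> (forall v, I (P v 1%g)) -> I a.
Proof.
case: (idI) => [_ _ Il Ir] [F <-] IP; apply: Il.
by apply: ideal_sum => v _; exact: IP.
Qed.

End IdealVertex.

(** * Representations on path spaces *)

Section DualEndomorphisms.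
Variables (R : comPzRingType) (conj : {rmorphism R -> R}).
Hypothesis conjK : involutive conj.
Variable M : lmodType R.

Definition is_linear (f : M -> M) :=
  forall (r : R) x y, f (r *: x + y) = r *: f x + f y.

(* The product of [End M] and its opposite: exchanging the two factors is an
   involution, which is conjugate-linear for the twisted scaling [dscale]. *)
Record dend := DEnd {
  dl : M -> M;
  dr : M -> M;
  dl_linear : is_linear dl;
  dr_linear : is_linear dr
}.

Lemma dend_eq (a b : dend) :
  (forall x, dl a x = dl b x) -> (forall x, dr a x = dr b x) -> a = b.
Proof.
case: a b => [f f' fL f'L] [g g' gL g'L] /= /funext fg /funext fg'.
by subst g g'; congr DEnd; exact: Prop_irrelevance.
Qed.

Lemma is_linearD f x y : is_linear f -> f (x + y) = f x + f y.
Proof. by move=> fL; rewrite -[x]scale1r fL !scale1r. Qed.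

Lemma is_linear0 f : is_linear f -> f 0 = 0.
Proof.
by move=> fL; apply: (addrI (f 0)); rewrite -(is_linearD _ _ fL) !addr0.
Qed.

Lemma is_linearZ f r x : is_linear f -> f (r *: x) = r *: f x.
Proof. by move=> fL; rewrite -[r *: x]addr0 fL (is_linear0 fL) addr0. Qed.

Lemma zero_linear : is_linear (fun=> 0).
Proof. by move=> r x y; rewrite scaler0 addr0. Qed.

Lemma add_linear f g :
  is_linear f -> is_linear g -> is_linear (fun x => f x + g x).
Proof. by move=> fL gL r x y; rewrite fL gL scalerDr addrACA. Qed.

Lemma scale_linear s f : is_linear f -> is_linear (fun x => s *: f x).
Proof. by move=> fL r x y; rewrite fL scalerDr !scalerA mulrC. Qed.

Lemma opp_linear f : is_linear f -> is_linear (fun x => - f x).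
Proof. by move=> fL r x y; rewrite fL opprD scalerN. Qed.

Lemma comp_linear f g : is_linear f -> is_linear g -> is_linear (f \o g).
Proof. by move=> fL gL r x y; rewrite /= gL fL. Qed.

HB.instance Definition _ := Choice.copy dend {classic dend}.

Definition dzero := DEnd zero_linear zero_linear.
Definition dadd a b := DEnd (add_linear (dl_linear a) (dl_linear b))
                            (add_linear (dr_linear a) (dr_linear b)).
Definition dopp a := DEnd (opp_linear (dl_linear a)) (opp_linear (dr_linear a)).
Definition dscale r a := DEnd (scale_linear r (dl_linear a))
                              (scale_linear (conj r) (dr_linear a)).
Definition dmul a b := DEnd (comp_linear (dl_linear a) (dl_linear b))
                            (comp_linear (dr_linear b) (dr_linear a)).
Definition dstar a := DEnd (dr_linear a) (dl_linear a).

Fact daddA : associative dadd.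
Proof. by move=> a b c; apply: dend_eq => x /=; rewrite addrA. Qed.
Fact daddC : commutative dadd.
Proof. by move=> a b; apply: dend_eq => x /=; rewrite addrC. Qed.
Fact dadd0 : left_id dzero dadd.
Proof. by move=> a; apply: dend_eq => x /=; rewrite add0r. Qed.
Fact daddN : left_inverse dzero dopp dadd.
Proof. by move=> a; apply: dend_eq => x /=; rewrite addNr. Qed.

HB.instance Definition _ :=
  GRing.isZmodule.Build dend daddA daddC dadd0 daddN.

Fact dscaleA r s a : dscale r (dscale s a) = dscale (r * s) a.
Proof. by apply: dend_eq => x /=; rewrite scalerA ?rmorphM. Qed.
Fact dscale1 : left_id 1 dscale.
Proof. by move=> a; apply: dend_eq => x /=; rewrite ?rmorph1 scale1r. Qed.
Fact dscaleDr : right_distributive dscale +%R.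
Proof. by move=> r a b; apply: dend_eq => x /=; rewrite scalerDr. Qed.
Fact dscaleDl a : {morph dscale^~ a : r s / r + s}.
Proof. by move=> r s; apply: dend_eq => x /=; rewrite ?rmorphD scalerDl. Qed.

HB.instance Definition _ := GRing.Zmodule_isLmodule.Build R dend
  dscaleA dscale1 dscaleDr dscaleDl.

Fact dmulA : associative dmul.
Proof. by move=> a b c; exact: dend_eq. Qed.
Fact dmulDl : left_distributive dmul +%R.
Proof.
move=> a b c; apply: dend_eq => x //=.
exact: is_linearD (dr_linear c).
Qed.
Fact dmulDr : right_distributive dmul +%R.
Proof.
move=> a b c; apply: dend_eq => x //=.
exact: is_linearD (dl_linear a).
Qed.
Fact dscaleAl (r : R) (a b : dend) : r *: dmul a b = dmul (r *: a) b.
Proof.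
apply: dend_eq => x //=.
by rewrite (is_linearZ _ _ (dr_linear b)).
Qed.
Fact dscaleAr (r : R) (a b : dend) : r *: dmul a b = dmul a (r *: b).
Proof.
apply: dend_eq => x //=.
by rewrite (is_linearZ _ _ (dl_linear a)).
Qed.
Fact dstarK : involutive dstar.
Proof. by case. Qed.
Fact dstarM a b : dstar (dmul a b) = dmul (dstar b) (dstar a).
Proof. exact: dend_eq. Qed.
(** Exchanging the factors also exchanges the scalings by [r] and [conj r]; they match because
    [conj] is involutive. *)
Fact dstarZD (r : R) (a b : dend) :
  dstar (r *: a + b) = conj r *: dstar a + dstar b.
Proof. by apply: dend_eq => x //=; rewrite conjK. Qed.

Definition dend_alg : starAlgebra conj := @StarAlgebra R conj dend dmul dstar
  dmulA dmulDl dmulDr dscaleAl dscaleAr dstarK dstarM dstarZD.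

Lemma dl0 x : dl (0 : dend_alg) x = 0. Proof. by []. Qed.
Lemma dr0 x : dr (0 : dend_alg) x = 0. Proof. by []. Qed.
Lemma dlD (a b : dend_alg) x : dl (a + b) x = dl a x + dl b x.
Proof. by []. Qed.
Lemma drD (a b : dend_alg) x : dr (a + b) x = dr a x + dr b x.
Proof. by []. Qed.
Lemma dlZ r (a : dend_alg) x : dl (r *: a) x = r *: dl a x. Proof. by []. Qed.
Lemma drZ r (a : dend_alg) x : dr (r *: a) x = conj r *: dr a x.
Proof. by []. Qed.

End DualEndomorphisms.

(** * Abstract path spaces and the representation of the family on functions *)

Section PathSpaces.
Variables (G : groupType) (E : graph) (X : self_similar_triple G E).

(* A set with the structure of the infinite path space: every point is
   uniquely of the form [pcons e z] with [rng (phd z) = src e] (the value of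
   [pcons e z] is irrelevant otherwise), compatibly with an action of [G]. *)
Record path_space := PathSpace {
  point :> Type;
  phd : point -> edge E;
  ptl : point -> point;
  pcons : edge E -> point -> point;
  pact : G -> point -> point;
  pact1 : forall z, pact 1%g z = z;
  pactM : forall g h z, pact (g * h)%g z = pact g (pact h z);
  phd_act : forall g z, phd (pact g z) = actE X g (phd z);
  ptl_act : forall g z, ptl (pact g z) = pact (coc X g (phd z)) (ptl z);
  rng_ptl : forall z, rng (phd (ptl z)) = src (phd z);
  pconsK : forall z, pcons (phd z) (ptl z) = z;
  phd_cons : forall e z, rng (phd z) = src e -> phd (pcons e z) = e;
  ptl_cons : forall e z, rng (phd z) = src e -> ptl (pcons e z) = z
}.

Variable Z : path_space.
Implicit Types (g h : G) (v w : vert E) (e f : edge E) (p q : seq (edge E)).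
Implicit Types (z : Z).

Definition prng z := rng (phd z).

Lemma prng_act g z : prng (pact g z) = actV X g (prng z).
Proof. by rewrite /prng phd_act act_rng. Qed.

Lemma prng_cons e z : prng z = src e -> prng (pcons e z) = rng e.
Proof. by move=> ze; rewrite /prng phd_cons. Qed.

Lemma pactKV g : cancel (@pact Z g^-1%g) (pact g).
Proof. by move=> z; rewrite -pactM mulgV pact1. Qed.

Lemma pact_cons g e z : prng z = src e ->
  pact g (pcons e z) = pcons (actE X g e) (pact (coc X g e) z).
Proof.
move=> ze; rewrite -[LHS](@pconsK Z).
by rewrite phd_act ptl_act phd_cons // ptl_cons.
Qed.

Lemma iter_ptl_act n g z :
  exists h, iter n (@ptl Z) (pact g z) = pact h (iter n (@ptl Z) z).
Proof.
elim: n => [|n [h IH]] /=; first by exists g.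
by rewrite IH ptl_act; eexists.
Qed.

Fixpoint starts_with p z : bool :=
  if p is e :: q then (phd z == e) && starts_with q (ptl z) else true.

Definition no_entry p := forall e f, e \in p -> rng f = rng e -> f = e.

Lemma no_entryP p : ~ has_entry p -> no_entry p.
Proof.
move=> noe e f ep fe; apply: contrapT => nfe; apply: noe; exists e => //.
by exists f, e.
Qed.

Lemma no_entry_starts_with p v z : no_entry p -> is_path v p -> prng z = v ->
  starts_with p z /\ prng (iter (size p) (@ptl Z) z) = path_src v p.
Proof.
elim: p v z => //= e p IH v z noe /andP[/eqP ev ep] zv.
have ze : phd z = e by apply: noe; rewrite ?mem_head // ev.
rewrite ze eqxx /= -iterS iterSr; apply: IH => //; last by rewrite /prng rng_ptl ze.
by move=> f f' fp; apply: noe; rewrite inE fp orbT.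
Qed.

Variables (R : comPzRingType) (conj : {rmorphism R -> R}).
Hypothesis conjK : involutive conj.

Definition pfun := Z -> R^o.
Implicit Types (F : pfun).

(** The operators of [p_(v,f)], [s_(e,g)] and [s_(e,g)^*]: each composes a function with a partially
    defined map of points and extends the result by zero. *)
Definition opP v (f : G) F : pfun :=
  fun z => if prng z == v then F (pact f^-1%g z) else 0.
Definition opS e g F : pfun :=
  fun z => if phd z == e then F (pact g^-1%g (ptl z)) else 0.
Definition opSt e g F : pfun :=
  fun z => if prng (pact g z) == src e then F (pcons e (pact g z)) else 0.

Fact opP_linear v (f : G) : is_linear (opP v f : (Z -> R^o) -> (Z -> R^o)).
Proof.
move=> r F F'; apply: funext => z; rewrite /opP /= !fctE.
by case: ifP; rewrite ?scaler0 ?addr0.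
Qed.
Fact opS_linear e g : is_linear (opS e g : (Z -> R^o) -> (Z -> R^o)).
Proof.
move=> r F F'; apply: funext => z; rewrite /opS /= !fctE.
by case: ifP; rewrite ?scaler0 ?addr0.
Qed.
Fact opSt_linear e g : is_linear (opSt e g : (Z -> R^o) -> (Z -> R^o)).
Proof.
move=> r F F'; apply: funext => z; rewrite /opSt /= !fctE.
by case: ifP; rewrite ?scaler0 ?addr0.
Qed.

Definition repA := dend_alg conjK (Z -> R^o).

Definition repP v (f : G) : repA :=
  DEnd (opP_linear v f) (opP_linear (actV X f^-1%g v) f^-1%g).
Definition repS e g : repA := DEnd (opS_linear e g) (opSt_linear e g).

Lemma opPP v (f : G) w h F : opP v f (opP w h F) =
  if v == actV X f w then opP v (f * h)%g F else 0.
Proof.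
apply: funext => z; rewrite /opP prng_act.
case: (prng z =P v) => [<-|nz]; last by case: ifP => //= _; case: eqP.
rewrite -(inj_eq (can_inj (actVK X f))) actVKV.
by case: ifP => //= _; rewrite eqxx invgM pactM.
Qed.

Lemma opPS v (f : G) e g F : opP v f (opS e g F) =
  if v == rng (actE X f e) then opS (actE X f e) (coc X f e * g)%g F else 0.
Proof.
apply: funext => z; rewrite /opP /opS phd_act ptl_act.
rewrite -(inj_eq (can_inj (actEK X f))) actEKV.
case: (phd z =P actE X f e) => [ze|/eqP/negPf nz]; last first.
  by do 2!case: ifP => //= _; rewrite nz.
rewrite /prng ze eq_sym; case: ifP => // _.
by rewrite /= ze eqxx cocV invgM pactM.
Qed.

(** The counterpart of [opPS] in the second factor of [repA], where products are reversed; [opPSt]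
    plays the same role for [opSP]. *)
Lemma opStP v (f : G) e g F : opSt e g (opP (actV X f^-1%g v) f^-1%g F) =
  if v == rng (actE X f e) then opSt (actE X f e) (coc X f e * g)%g F else 0.
Proof.
apply: funext => z; rewrite /opP /opSt.
case: (prng (pact g z) =P src e) => ze; last first.
  case: ifP => //= _; rewrite pactM prng_act act_src coc_actV.
  by rewrite (inj_eq (can_inj (actVK X f))); case: eqP.
rewrite prng_cons // invgK act_rng.
rewrite -(inj_eq (can_inj (actVK X f))) actVKV eq_sym; case: ifP => //= _.
by rewrite pactM prng_act act_src coc_actV ze eqxx pact_cons.
Qed.

Lemma opSP e g v (f : G) F : opS e g (opP v f F) =
  if actV X g v == src e then opS e (g * f)%g F else 0.
Proof.
apply: funext => z; rewrite /opP /opS.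
case: (phd z =P e) => [<-|nz]; last by case: ifP => //= _; case: eqP.
rewrite prng_act /prng rng_ptl -(inj_eq (can_inj (actVK X g))) actVKV eq_sym.
by case: ifP => //= _; rewrite eqxx invgM pactM.
Qed.

Lemma opPSt v (f : G) e g F : opP (actV X f^-1%g v) f^-1%g (opSt e g F) =
  if actV X g v == src e then opSt e (g * f)%g F else 0.
Proof.
apply: funext => z; rewrite /opP /opSt invgK.
case: (prng z =P actV X f^-1%g v) => [zv|nz].
  have -> : (actV X g v == src e) = (prng (pact g (pact f z)) == src e).
    by rewrite !prng_act zv actVKV.
  by case: ifP => //= zge; rewrite pactM zge.
case: ifP => //= /eqP gv; rewrite pactM; case: eqP => // ge; case: nz.
apply: (can_inj (actVK X f)); apply: (can_inj (actVK X g)).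
by rewrite -!prng_act ge actVKV.
Qed.

Lemma opStS e f F : opSt e 1%g (opS f 1%g F) =
  if e == f then opP (src e) 1%g F else 0.
Proof.
apply: funext => z; rewrite /opP /opSt /opS invg1 !pact1.
case: eqP => ze; last by case: ifP => //= _; case: eqP.
rewrite phd_cons // ptl_cons //.
by case: ifP => //= _; rewrite ze eqxx ?invg1 ?pact1.
Qed.

Lemma opSSt e F z : opS e 1%g (opSt e 1%g F) z = if phd z == e then F z else 0.
Proof.
rewrite /opSt /opS invg1 !pact1; case: eqP => // <-.
by rewrite /prng rng_ptl eqxx pconsK.
Qed.

Lemma dl_sum (T : Type) (l : seq T) (Q : pred T) (a : T -> repA) F :
  dl (\sum_(i <- l | Q i) a i) F = \sum_(i <- l | Q i) dl (a i) F.
Proof. exact: (big_morph (fun a : repA => dl a F)). Qed.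

Lemma dr_sum (T : Type) (l : seq T) (Q : pred T) (a : T -> repA) F :
  dr (\sum_(i <- l | Q i) a i) F = \sum_(i <- l | Q i) dr (a i) F.
Proof. exact: (big_morph (fun a : repA => dr a F)). Qed.

(** A point has exactly one first edge, so at [z] only the term of [phd z] can survive. *)
Lemma opP_sum v F :
  opP v 1%g F = \sum_(e <- finmap.enum_fset (fset_set [set e : edge E | rng e = v]%classic))
    opS e 1%g (opSt e 1%g F).
Proof.
have fin := ss_row_finite X v.
apply: funext => z; rewrite fct_sumE /opP invg1 pact1.
case: eqP => [zv|nz].
  rewrite (bigD1_seq (phd z)) ?finmap.fset_uniq ?in_fset_set ?inE //=.
  rewrite opSSt eqxx big1 ?addr0 // => e ez.
  by rewrite opSSt eq_sym (negPf ez).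
rewrite big_seq big1 // => e; rewrite in_fset_set // inE /= => ev.
by rewrite opSSt; case: eqP => // ze; case: nz; rewrite /prng ze.
Qed.

Lemma rep_family : GE_family X repP repS.
Proof.
split; first split.
- move=> v; split; apply: dend_eq => F //=.
  + by rewrite invg1 actV1.
  + by rewrite invg1 actV1.
  + by rewrite opPP actV1 eqxx mulg1.
  + by rewrite invg1 opPP !actV1 eqxx mulg1.
- move=> v w vw; apply: dend_eq => F /=.
    by rewrite opPP actV1; case: eqP.
  by rewrite invg1 opPP !actV1 mulg1; case: eqP => // wv; case: vw.
- move=> e; apply: dend_eq => F; apply: funext => z /=.
    by rewrite opSSt /opS; case: eqP.
  by rewrite opStS eqxx /opP /opSt invg1 !pact1; case: eqP => // ->; rewrite eqxx.
- move=> e f; apply: dend_eq => F /=; rewrite opStS.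
    by case: eqP.
  by rewrite eq_sym; case: eqP => // ->; rewrite /= invg1 actV1.
- move=> v; have fin := ss_row_finite X v.
  rewrite fsbig_finite //; apply: dend_eq => F.
    rewrite dl_sum; exact: opP_sum.
  rewrite dr_sum /= invg1 actV1; exact: opP_sum.
- move=> v f; apply: dend_eq => F //=.
  by rewrite invgK actVKV.
- move=> v f w h; apply: dend_eq => F /=.
    by rewrite opPP; case: ifP.
  rewrite opPP (inj_eq (can_inj (actVKV X h))).
  rewrite -(inj_eq (can_inj (actVK X f))) actVKV eq_sym.
  by case: (v =P _) => //= ->; rewrite !invgM actVM actVK.
- move=> v f e g; apply: dend_eq => F /=.
    by rewrite opPS; case: ifP.
  by rewrite opStP; case: ifP.
- move=> e g v f; apply: dend_eq => F /=.
    by rewrite opSP; case: ifP.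
  by rewrite opPSt; case: ifP.
Qed.

End PathSpaces.

(** * Stable submodules and the ideals they define *)

Section StableSubmodules.
Variables (R : comPzRingType) (conj : {rmorphism R -> R}).
Hypothesis conjK : involutive conj.
Variables (G : groupType) (E : graph) (X : self_similar_triple G E).
Variable Z : path_space X.

Let rep := LR_eval (repP Z conjK) (repS Z conjK) : LR conj X -> repA Z conjK.
Let repF := rep_family Z conjK.

Definition act_on (a : LR conj X) : (Z -> R^o) -> (Z -> R^o) := dl (rep a).

Lemma act_on_p v g : act_on (LR_p conj X v g) = opP v g.
Proof. by rewrite /act_on /rep LR_eval_p. Qed.

Lemma act_on_s e g : act_on (LR_s conj X e g) = opS e g.
Proof. by rewrite /act_on /rep LR_eval_s. Qed.

Lemma act_onM (a b : LR conj X) F : act_on (a ** b) F = act_on a (act_on b F).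
Proof. by have [_ repM _] := LR_eval_hom repF; rewrite /act_on /rep repM. Qed.

Lemma act_onB (a b : LR conj X) F : act_on (a - b) F = act_on a F - act_on b F.
Proof.
have [repL _ _] := LR_eval_hom repF.
by rewrite -scaleN1r addrC /act_on /rep repL /= scaleN1r addrC.
Qed.

Lemma act_onZ r (a : LR conj X) F : act_on (r *: a) F = r *: act_on a F.
Proof. by rewrite /act_on /rep (LR_evalZ repF). Qed.

Lemma act_on0 F : act_on 0 F = 0.
Proof. by rewrite /act_on /rep (LR_eval0 repF). Qed.

Lemma act_on_pmul p (a : LR conj X) F z :
  act_on (pmul (LR_s conj X) p a) F z =
  if starts_with p z then act_on a F (iter (size p) (@ptl _ _ _ Z) z) else 0.
Proof.
elim: p z => //= e p IH z; rewrite act_onM act_on_s /opS invg1 pact1.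
by case: eqP => //= _; rewrite IH -iterS iterSr.
Qed.

Record op_stable (N : (Z -> R^o) -> Prop) : Prop := OpStable {
  inv0 : N 0;
  invL : forall (r : R) F F', N F -> N F' -> N (r *: F + F');
  invP : forall v g F, N F -> N (opP v g F);
  invS : forall e g F, N F -> N (opS e g F);
  invSt : forall e g F, N F -> N (opSt e g F)
}.

(** Both components are treated at once because the adjoint exchanges them. *)
Lemma eval_stable (N : (Z -> R^o) -> Prop) (t : term R G E) F :
    op_stable N -> N F ->
  N (dl (eval (repP Z conjK) (repS Z conjK) t) F) /\
  N (dr (eval (repP Z conjK) (repS Z conjK) t) F).
Proof.
move=> NI; have invD F1 F2 : N F1 -> N F2 -> N (F1 + F2).
  by move=> N1 N2; rewrite -[F1]scale1r; exact: invL.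
have invZ r F1 : N F1 -> N (r *: F1).
  by move=> N1; rewrite -[_ *: _]addr0; apply: invL => //; exact: inv0.
elim: t F => [v g|e g||t IHt u IHu|r t IHt|t IHt u IHu|t IHt] F NF; cbn [eval].
- by split; exact: invP.
- by split; [exact: invS|exact: invSt].
- by rewrite dl0 dr0; split; exact: inv0.
- by have [? ?] := IHt F NF; have [? ?] := IHu F NF; rewrite dlD drD; split; exact: invD.
- by have [? ?] := IHt F NF; rewrite dlZ drZ; split; exact: invZ.
- split; first by have [/IHt[]] := IHu F NF.
  by have [_ /IHu[]] := IHt F NF.
- by have [? ?] := IHt F NF.
Qed.

Lemma act_on_stable (N : (Z -> R^o) -> Prop) (a : LR conj X) F :
  op_stable N -> N F -> N (act_on a F).
Proof. by move=> NI NF; have [] := eval_stable (repr a) NI NF. Qed.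

(** The elements sending [N] into [K] form a two-sided ideal: stability of [K] gives left multiples,
    stability of [N] right multiples. *)
Lemma simple_dichotomy (N K : (Z -> R^o) -> Prop) :
    simple_ring (@amul R conj (LR conj X)) -> op_stable N -> op_stable K ->
  (forall a, (forall F, N F -> K (act_on a F)) -> a = 0) \/
  (forall a F, N F -> K (act_on a F)).
Proof.
move=> [_ simple] NI KI.
pose I : set (LR conj X) := fun a => forall F, N F -> K (act_on a F).
case: (simple I) => [|I0|IT]; first split.
- by move=> F _; rewrite act_on0; exact: inv0.
- move=> a b Ia Ib F NF; rewrite act_onB addrC -scaleN1r.
  by apply: invL => //; [exact: Ib|exact: Ia].
- by move=> a b Ib F NF; rewrite act_onM; apply: act_on_stable => //; exact: Ib.
- by move=> a b Ib F NF; rewrite act_onM; apply: Ib; exact: act_on_stable.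
- by left=> a Ia; have : [set 0 : LR conj X]%classic a by rewrite -I0.
- by right=> a; have : setT a by []; rewrite -IT.
Qed.

Lemma op_stable_all : op_stable (fun=> True).
Proof. by split. Qed.

Lemma op_stable_zero : op_stable (fun F => F = 0).
Proof.
split=> // [r _ _ -> ->|v g _ ->|e g _ ->|e g _ ->].
- by rewrite scaler0 addr0.
- exact: is_linear0 (opP_linear _ _).
- exact: is_linear0 (opS_linear _ _).
- exact: is_linear0 (opSt_linear _ _).
Qed.

Lemma op_stable_ideal (J : set R) : two_sided_ideal (@GRing.mul R) J ->
  op_stable (fun F => forall z, J (F z)).
Proof.
case=> J0 JB Jl _.
split=> // [r F F' JF JF' z|v g F JF z|e g F JF z|e g F JF z].
- rewrite !fctE -[F' z]opprK; apply: (JB (r * F z)); first exact: Jl.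
  by rewrite -sub0r; exact: JB.
- by rewrite /opP; case: ifP.
- by rewrite /opS; case: ifP.
- by rewrite /opSt; case: ifP.
Qed.

Lemma op_stable_vanish (W : Z -> Prop) :
    (forall z, W z -> W (ptl z)) -> (forall g z, W z -> W (pact g z)) ->
    (forall e z, prng z = src e -> W z -> W (pcons e z)) ->
  op_stable (fun F => forall z, W z -> F z = 0).
Proof.
move=> Wt Wa Wc.
split=> // [r F F' JF JF' z Wz|v g F JF z Wz|e g F JF z Wz|e g F JF z Wz].
- by rewrite /= !fctE JF // JF' // scaler0 addr0.
- by rewrite /opP; case: ifP => // _; apply: JF; exact: Wa.
- by rewrite /opS; case: ifP => // _; apply: JF; apply/Wa/Wt.
- rewrite /opSt; case: ifP => // /eqP ze; apply: JF; apply: Wc => //; exact: Wa.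
Qed.

Lemma op_stable_factor (D : Z -> Z -> Prop) :
    (forall z z', D z z' -> phd z = phd z') ->
    (forall z z', D z z' -> D (ptl z) (ptl z')) ->
    (forall g z z', D z z' -> D (pact g z) (pact g z')) ->
    (forall e z z', prng z = src e -> D z z' -> D (pcons e z) (pcons e z')) ->
  op_stable (fun F => forall z z', D z z' -> F z = F z').
Proof.
move=> Dh Dt Da Dc.
split=> // [r F F' JF JF' z z' Dz|v g F JF z z' Dz|e g F JF z z' Dz|e g F JF z z' Dz].
- by rewrite /= !fctE (JF _ _ Dz) (JF' _ _ Dz).
- rewrite /opP /prng (Dh _ _ Dz); case: ifP => // _; apply: JF; exact: Da.
- rewrite /opS (Dh _ _ Dz); case: ifP => // _; apply: JF; apply/Da/Dt.
  exact: Dz.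
- rewrite /opSt /prng (Dh _ _ (Da g _ _ Dz)); case: ifP => // /eqP ze.
  by apply: JF; apply: Dc; [rewrite /prng (Dh _ _ (Da g _ _ Dz))|exact: Da].
Qed.

End StableSubmodules.

(** * Sequences in [G] modulo eventual equality *)

Section Germs.
Variable G : groupType.

Definition evt_eq (c d : nat -> G) : bool :=
  `[< exists N, forall n, (N <= n)%N -> c n = d n >].

Fact evt_eq_refl : reflexive evt_eq.
Proof. by move=> c; apply/asboolP; exists 0%N. Qed.
Fact evt_eq_sym : symmetric evt_eq.
Proof.
by move=> c d; apply/asboolP/asboolP => -[N cd]; exists N => n /cd.
Qed.
Fact evt_eq_trans : transitive evt_eq.
Proof.
move=> d c e /asboolP[N cd] /asboolP[M de]; apply/asboolP.
by exists (maxn N M) => n; rewrite geq_max => /andP[/cd -> /de].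
Qed.

Definition evt_eqrel := EquivRel evt_eq evt_eq_refl evt_eq_sym evt_eq_trans.

Local Open Scope quotient_scope.

Definition germ : Type := {eq_quot evt_eqrel}.
HB.instance Definition _ := Choice.on germ.
HB.instance Definition _ := EqQuotient.on germ.

Definition germ_of (c : nat -> G) : germ := \pi_germ c.

Lemma germP c d :
  germ_of c = germ_of d <-> exists N, forall n, (N <= n)%N -> c n = d n.
Proof. by split=> [/eqmodP/asboolP //|cd]; apply/eqmodP/asboolP. Qed.

Lemma germ_repr c : exists N, forall n, (N <= n)%N -> repr (germ_of c) n = c n.
Proof. by apply/germP; exact: reprK. Qed.

Definition germ_mul (u : nat -> G) (q : germ) :=
  germ_of (fun n => u n * repr q n)%g.
Definition germ_tl (q : germ) := germ_of (fun n => repr q n.+1).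
(** The predecessor repeats the value at 0, which is harmless as finitely many terms do not
    count. *)
Definition germ_cons (q : germ) := germ_of (fun n => repr q n.-1).

Lemma germ_mul_of u c : germ_mul u (germ_of c) = germ_of (fun n => u n * c n)%g.
Proof.
by apply/germP; have [N cE] := germ_repr c; exists N => n /cE ->.
Qed.

Lemma germ_tl_of c : germ_tl (germ_of c) = germ_of (fun n => c n.+1).
Proof.
apply/germP; have [N cE] := germ_repr c; exists N => n len.
by rewrite cE // (leq_trans len).
Qed.

Lemma germ_cons_of c : germ_cons (germ_of c) = germ_of (fun n => c n.-1).
Proof.
apply/germP; have [N cE] := germ_repr c; exists N.+1 => -[//|n] len.
by rewrite cE.
Qed.

Lemma germ_ind (Q : germ -> Prop) : (forall c, Q (germ_of c)) -> forall q, Q q.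
Proof. by move=> H q; have := H (repr q); rewrite /germ_of reprK. Qed.

End Germs.

(** * The path space of infinite paths with degree and germ *)

Section GermPathSpace.
Variables (G : groupType) (E : graph) (X : self_similar_triple G E).
Implicit Types (g h : G) (e : edge E).

Definition infpath := {x : nat -> edge E | is_infpath x}.

Lemma infpath_eq (x y : infpath) : (forall n, sval x n = sval y n) -> x = y.
Proof.
case: x y => [x xx] [y yy] /= /funext xy; subst y.
by congr exist; exact: Prop_irrelevance.
Qed.

Fact act_infpath g (x : infpath) : is_infpath (act_inf X g (sval x)).
Proof.
by case: x => x xx n; rewrite /act_inf act_src act_rng !coc_path_actV xx.
Qed.

Fact tl_infpath (x : infpath) : is_infpath (fun n => sval x n.+1).
Proof. by case: x => x xx n; exact: xx. Qed.

Definition cons_seq e (x : nat -> edge E) : nat -> edge E :=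
  fun n => if n is m.+1 then x m else e.

(** When [e] cannot be put in front of [x], the path is left unchanged so that the operation is
    total. *)
Fact cons_infpath e (x : infpath) :
  is_infpath (if rng (sval x 0%N) == src e then cons_seq e (sval x) else sval x).
Proof.
case: x => x xx /=; case: eqP => // xe -[|n] /=; last exact: xx.
by rewrite xe.
Qed.

Definition ip_act g x : infpath := exist _ _ (act_infpath g x).
Definition ip_tl x : infpath := exist _ _ (tl_infpath x).
Definition ip_cons e x : infpath := exist _ _ (cons_infpath e x).

Lemma mkseq_tl (x : nat -> edge E) n :
  mkseq x n.+1 = x 0%N :: mkseq (fun m => x m.+1) n.
Proof.
by elim: n => // n IH; rewrite mkseqS IH (mkseqS (fun m => x m.+1)).
Qed.

Lemma act_inf1 x : act_inf X 1%g x =1 x.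
Proof. by move=> n; rewrite /act_inf coc_path1 actE1. Qed.

Lemma act_infM g h x : act_inf X (g * h)%g x =1 act_inf X g (act_inf X h x).
Proof.
by move=> n; rewrite /act_inf coc_pathM actEM -act_inf_prefix.
Qed.

Lemma act_inf_tl g x n : act_inf X g x n.+1 =
  act_inf X (coc X g (x 0%N)) (fun m => x m.+1) n.
Proof. by rewrite /act_inf mkseq_tl. Qed.

(* The germ records the restrictions of the group elements applied so far to
   ever longer prefixes, and the integer records the degree; on these points
   distinct elements of the groupoid of germs act differently. *)
Definition gp := (infpath * int * germ G)%type.

Definition gp_hd (z : gp) : edge E := sval z.1.1 0%N.
Definition gp_tl (z : gp) : gp := (ip_tl z.1.1, z.1.2 - 1, germ_tl z.2).
Definition gp_cons e (z : gp) : gp :=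
  (ip_cons e z.1.1, z.1.2 + 1, germ_cons z.2).
Definition gp_act g (z : gp) : gp :=
  (ip_act g z.1.1, z.1.2,
   germ_mul (fun n => coc_path X g (mkseq (sval z.1.1) n)) z.2).

Fact gp_act1 z : gp_act 1%g z = z.
Proof.
case: z => [[x k] q]; rewrite /gp_act /=; congr (_, _, _).
  by apply: infpath_eq; exact: act_inf1.
elim/germ_ind: q => c; rewrite germ_mul_of; congr germ_of; apply: funext => n.
by rewrite coc_path1 mul1g.
Qed.

Fact gp_actM g h z : gp_act (g * h)%g z = gp_act g (gp_act h z).
Proof.
case: z => [[x k] q]; rewrite /gp_act /=; congr (_, _, _).
  by apply: infpath_eq; exact: act_infM.
elim/germ_ind: q => c; rewrite !germ_mul_of; congr germ_of; apply: funext => n.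
by rewrite coc_pathM act_inf_prefix mulgA.
Qed.

Fact gp_hd_act g z : gp_hd (gp_act g z) = actE X g (gp_hd z).
Proof. by []. Qed.

Fact gp_tl_act g z : gp_tl (gp_act g z) = gp_act (coc X g (gp_hd z)) (gp_tl z).
Proof.
case: z => [[x k] q]; rewrite /gp_act /gp_tl /gp_hd /=; congr (_, _, _).
  by apply: infpath_eq; exact: act_inf_tl.
elim/germ_ind: q => c; rewrite !(germ_mul_of, germ_tl_of).
by congr germ_of; apply: funext => n; rewrite mkseq_tl.
Qed.

Fact gp_rng_tl z : rng (gp_hd (gp_tl z)) = src (gp_hd z).
Proof. by case: z => [[[x xx] k] q]; rewrite /gp_hd /= xx. Qed.

Fact gp_consK z : gp_cons (gp_hd z) (gp_tl z) = z.
Proof.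
have := gp_rng_tl z.
case: z => [[x k] q]; rewrite /gp_cons /gp_tl /gp_hd /= => xx; congr (_, _, _).
- by apply: infpath_eq => -[|n] /=; rewrite xx eqxx.
- by rewrite subrK.
elim/germ_ind: q => c; rewrite !(germ_tl_of, germ_cons_of); apply/germP.
by exists 1%N => -[].
Qed.

Fact gp_hd_cons e z : rng (gp_hd z) = src e -> gp_hd (gp_cons e z) = e.
Proof. by rewrite /gp_hd /= => ->; rewrite eqxx. Qed.

Fact gp_tl_cons e z : rng (gp_hd z) = src e -> gp_tl (gp_cons e z) = z.
Proof.
case: z => [[x k] q]; rewrite /gp_cons /gp_tl /gp_hd /= => xe; congr (_, _, _).
- by apply: infpath_eq => n /=; rewrite xe eqxx.
- by rewrite addrK.
by elim/germ_ind: q => c; rewrite !(germ_tl_of, germ_cons_of).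
Qed.

Definition germ_space : path_space X := PathSpace gp_act1 gp_actM gp_hd_act
  gp_tl_act gp_rng_tl gp_consK gp_hd_cons gp_tl_cons.

Definition same_path (z z' : gp) := z.1.1 = z'.1.1.

Lemma op_stable_same_path (R : comPzRingType) :
  @op_stable R G E X germ_space (fun F => forall z z', same_path z z' -> F z = F z').
Proof.
apply: op_stable_factor; rewrite /same_path /=.
- by move=> z z'; rewrite /gp_hd => ->.
- by move=> z z' ->.
- by move=> g z z' ->.
- by move=> e z z' _ ->.
Qed.

End GermPathSpace.

(** * Simplicity *)

Section Sufficiency.
Variables (R : comPzRingType) (conj : {rmorphism R -> R}).
Variables (G : groupType) (E : graph) (X : self_similar_triple G E).

Lemma astarD (A : starAlgebra conj) (a b : A) : (a + b)^† = a^† + b^†.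
Proof. by rewrite -[a]scale1r astarZD rmorph1 !scale1r. Qed.

Lemma astar0 (A : starAlgebra conj) : (0 : A)^† = 0.
Proof. by apply: (addrI 0^†); rewrite -astarD !addr0. Qed.

Lemma astarZ (A : starAlgebra conj) r (a : A) : (r *: a)^† = conj r *: a^†.
Proof. by rewrite -[r *: a]addr0 astarZD astar0 addr0. Qed.

Lemma LR_ind (Q : LR conj X -> Prop) :
  (forall v g, Q (LR_p conj X v g)) -> (forall e g, Q (LR_s conj X e g)) ->
  Q 0 -> (forall a b, Q a -> Q b -> Q (a + b)) ->
  (forall r a, Q a -> Q (r *: a)) -> (forall a b, Q a -> Q b -> Q (a ** b)) ->
  (forall a, Q a -> Q a^†) -> forall a, Q a.
Proof.
move=> Qp Qs Q0 QD QZ QM QS a; rewrite -[a]cls_repr.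
elim: (repr a) => [v g|e g||t IHt u IHu|r t IHt|t IHt u IHu|t IHt].
- exact: Qp.
- exact: Qs.
- exact: Q0.
- suff -> : cls conj X (TAdd t u) = (cls conj X t : LR conj X) + cls conj X u.
    exact: QD.
  by apply: LR_ext => B P S PS; rewrite LR_evalD // !LR_eval_cls.
- suff -> : cls conj X (TScale r t) = r *: (cls conj X t : LR conj X).
    exact: QZ.
  by apply: LR_ext => B P S PS; rewrite LR_evalZ // !LR_eval_cls.
- suff -> : cls conj X (TMul t u) = (cls conj X t : LR conj X) ** cls conj X u.
    exact: QM.
  by apply: LR_ext => B P S PS; rewrite LR_evalM // !LR_eval_cls.
- suff -> : cls conj X (TStar t) = (cls conj X t : LR conj X)^† by exact: QS.
  by apply: LR_ext => B P S PS; rewrite LR_evalS // !LR_eval_cls.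
Qed.

Let PS := LR_family conj X.

(** Proved for [a] and its adjoint together, since otherwise the induction could not pass through
    the star. *)
Lemma LR_tame (a : LR conj X) : tame X (LR_p conj X) (LR_s conj X) a.
Proof.
suff [] : tame X (LR_p conj X) (LR_s conj X) a /\
          tame X (LR_p conj X) (LR_s conj X) a^† by [].
elim/LR_ind: a => [v g|e g||a b [? ?] [? ?]|r a [? ?]|a b [? ?] [? ?]|a [? ?]].
- by rewrite (gef_starP PS); split; exact: tame_P.
- by split; [exact: tame_S|exact: tame_starS].
- by rewrite astar0; split; exact: tame0.
- by rewrite astarD; split; exact: tameD.
- by rewrite astarZ; split; exact: tameZ.
- by rewrite astarM; split; exact: tameM.
- by rewrite astarK; split.
Qed.

Lemma LR_runital (a : LR conj X) : runital (LR_p conj X) a.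
Proof.
suff [] : runital (LR_p conj X) a /\ runital (LR_p conj X) a^† by [].
elim/LR_ind: a => [v g|e g||a b [? ?] [? ?]|r a [? ?]|a b [? ?] [? ?]|a [? ?]].
- by rewrite (gef_starP PS); split; exact: (runital_P PS).
- by split; [exact: (runital_S PS)|exact: (runital_starS PS)].
- by rewrite astar0; split; exists [::]; rewrite amul0r.
- by rewrite astarD; split; exact: (runitalD PS).
- by rewrite astarZ; split; exact: runitalZ.
- by rewrite astarM; split; exact: runitalM.
- by rewrite astarK; split.
Qed.

Lemma simple_ring_inv : simple_ring (@GRing.mul R) ->
  forall c : R, c != 0 -> exists d, d * c = 1.
Proof.
move=> [_ simple] c nzc; pose J : set R := fun x => exists d, d * c = x.
case: (simple J) => [|J0|JT]; first split.
- by exists 0; rewrite mul0r.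
- by move=> _ _ [d <-] [d' <-]; exists (d - d'); rewrite mulrBl.
- by move=> a _ [d <-]; exists (a * d); rewrite mulrA.
- by move=> a _ [d <-]; exists (a * d); rewrite [RHS]mulrC mulrA.
- have Jc : J c by exists 1; rewrite mul1r.
  by case/eqP: nzc; rewrite J0 in Jc.
by have : J 1 by rewrite JT.
Qed.

End Sufficiency.

(** * Consequences of simplicity *)

Section Necessity.
Variables (R : comPzRingType) (conj : {rmorphism R -> R}).
Hypothesis conjK : involutive conj.
Variables (G : groupType) (E : graph) (X : self_similar_triple G E).
Implicit Types (v w u : vert E) (g h : G) (e f : edge E) (p q : seq (edge E)).

Let Z := germ_space X.
Notation act_on := (@act_on R conj conjK G E X Z).

Definition base_point (x : infpath E) : Z := (x, 0, germ_of (fun=> 1%g)).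

Lemma exists_point v : exists x : infpath E, prng (base_point x) = v.
Proof.
have [e _|x [xx xv _]] := @exists_infpath _ _ X v (fun=> True) I.
  by have [f fe] := exists_edge X e; exists f.
by exists (exist _ x xx).
Qed.

Lemma LR_p_neq0 v : (1 : R) <> 0 -> LR_p conj X v 1%g <> 0.
Proof.
move=> one0 p0; apply: one0; have [x xv] := exists_point v.
have := congr1 (fun a => act_on a (fun=> 1) (base_point x)) p0.
by rewrite /= act_on_p act_on0 /opP xv eqxx.
Qed.

Hypothesis simple : simple_ring (@amul R conj (LR conj X)).

Lemma simple_one_neq0 : (1 : R) <> 0.
Proof.
case: simple => [[a nza] _] one0; apply: nza.
by rewrite -[a]scale1r one0 scale0r.
Qed.

(** In the first alternative every [r] in [J] satisfies [r *: p_v = 0], whence [r = 0]; in the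
    second [p_v] sends the constant 1 to a [J]-valued function, whence [J] contains 1. *)
Lemma simple_coef : simple_ring (@GRing.mul R).
Proof.
split; first by exists 1; exact: simple_one_neq0.
move=> J idJ; have [v] := vert_nonempty E; have [x xv] := exists_point v.
have [J0|JT] := simple_dichotomy conjK simple (op_stable_all R Z) (op_stable_ideal Z idJ).
  left; apply/seteqP; split=> r /=; last by move=> ->; case: idJ.
  case: idJ => _ _ Jl Jr Jl0; have rp0 : r *: LR_p conj X v 1%g = 0.
    by apply: J0 => F _ z; rewrite act_onZ; exact: Jr.
  have := congr1 (fun a => act_on a (fun=> 1) (base_point x)) rp0.
  by rewrite /= act_onZ act_on_p act_on0 !fctE /opP xv eqxx /GRing.scale /= mulr1.
right; apply/seteqP; split=> r // _; case: (idJ) => _ _ Jl _.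
rewrite -[r]mulr1; apply: Jl.
have := JT (LR_p conj X v 1%g) (fun=> 1) I (base_point x).
by rewrite act_on_p /opP xv eqxx.
Qed.

Lemma simple_transitive : weakly_G_transitive X.
Proof.
move=> xi x xi_path.
pose C u := exists v, (exists i, v = rng (xi i) \/ v = src (xi i)) /\
  exists (g : G) p, is_path u p /\ path_src u p = actV X g v.
have Cact g u : C u -> C (actV X g u).
  case=> v [xiv [h [p [up srcp]]]]; exists v; split=> //.
  exists (g * h)%g, (act_path X g p); split; first exact: is_path_act.
  by rewrite path_src_act srcp actVM.
have Csrc e : C (src e) -> C (rng e).
  case=> v [xiv [h [p [up srcp]]]]; exists v; split=> //.
  by exists h, (e :: p); rewrite /= eqxx.
apply: contrapT => nCx.
(* As [x] is not in [C], everything in the image of [p_x] vanishes on [W], so the ideal is not zero.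
   It is not everything either: [xi] gives a point of [W] where the projection at its range sends
   the constant 1 to 1. *)
pose W (z : Z) := forall n, C (prng (iter n (@ptl _ _ _ Z) z)).
have inv : @op_stable R G E X Z (fun F => forall z, W z -> F z = 0).
  apply: op_stable_vanish => [z Wz n|g z Wz n|e z ze Wz [|n]].
  - by rewrite -iterSr; exact: Wz.
  - by have [h ->] := iter_ptl_act n g z; rewrite prng_act; exact/Cact/Wz.
  - by rewrite /= prng_cons //; apply: Csrc; rewrite -ze; exact: (Wz 0%N).
  - by rewrite iterSr ptl_cons //; exact: Wz.
have [I0|IT] := simple_dichotomy conjK simple (op_stable_all R Z) inv.
  apply: (@LR_p_neq0 x simple_one_neq0); apply: I0 => F _ z Wz.
  rewrite act_on_p /opP; case: eqP => // zx; case: nCx.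
  by rewrite -/(C x) -zx; exact: (Wz 0%N).
apply: simple_one_neq0.
pose y := base_point (exist _ xi xi_path).
have hdy n : gp_hd (iter n (@ptl _ _ _ Z) y) = xi n.
  suff H m : sval (iter n (@ptl _ _ _ Z) y).1.1 m = xi (n + m)%N.
    by rewrite /gp_hd H addn0.
  by elim: n m => //= n IH m; rewrite IH addnS.
have := IT (LR_p conj X (rng (xi 0%N)) 1%g) (fun=> 1) I y.
rewrite act_on_p /opP eqxx; apply=> n; rewrite /prng /= hdy.
exists (rng (xi n)); split; first by exists n; left.
by exists 1%g, [::]; rewrite actV1.
Qed.

(** The [G]-translates of the ranges of the edges of [p] each receive a single edge, whose source is
    again such a translate. So only one infinite path has range [v]. *)
Lemma circuit_same_path g v p (z z' : Z) :
    G_circuit X g v p -> no_entry p -> prng z = v -> prng z' = v ->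
  same_path z z'.
Proof.
case=> vp p0 srcp noe zv z'v.
pose C u := exists h, exists2 e, e \in p & u = actV X h (rng e).
have Cuniq u f : C u -> rng f = u -> exists h, exists2 e, e \in p &
    actV X h (rng e) = u /\ f = actE X h e.
  case=> h [e ep ->] fu; exists h, e => //; split=> //.
  rewrite -[f](actEKV X h); congr actE; apply: noe => //.
  by rewrite act_rng fu actVK.
have [e0 e0p e0v] : exists2 e, e \in p & rng e = v.
  case: p vp p0 {srcp noe C Cuniq} => //= e p /andP[/eqP ev _] _.
  by exists e; rewrite ?mem_head.
have Csrc f : C (rng f) -> C (src f).
  move=> Cf; have [h [e ep [_ ->]]] := Cuniq _ _ Cf erefl.
  rewrite act_src; have [->|[f' f'p <-]] := path_edge_src vp ep.
    by exists (h * g)%g, e0; rewrite // srcp actVM e0v.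
  by exists h, f'.
have Cv : C v by exists 1%g, e0; rewrite ?actV1.
case: z z' zv z'v => [[[x xx] k] q] [[[y yy] k'] q']; rewrite /prng /same_path.
rewrite /= /gp_hd /= => xv yv; apply: infpath_eq => n /=.
have CC f f' u : C u -> rng f = u -> rng f' = u -> f = f'.
  move=> Cu fu f'u; have [h [e ep [eu ->]]] := Cuniq u f Cu fu.
  rewrite -[RHS](actEKV X h); congr actE; apply/esym/noe => //.
  by rewrite act_rng f'u -eu actVK.
suff [] : x n = y n /\ C (rng (x n)) by [].
elim: n => [|n [IH1 IH2]]; first by rewrite xv; split=> //; exact: CC Cv _ _.
have Cn : C (rng (x n.+1)) by rewrite -xx; exact: Csrc.
by split=> //; apply: CC Cn _ _ => //; rewrite -xx -yy IH1.
Qed.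

(** Without an entry [s_p u_g] and [p_v] agree on functions of the path alone, so simplicity would
    make them equal; yet the former shifts the degree by the length of [p]. *)
Lemma simple_entry g v p : G_circuit X g v p -> has_entry p.
Proof.
move=> circ; apply: contrapT => /no_entryP noe.
have [vp p0 srcp] := circ.
pose a := mono X (LR_p conj X) (LR_s conj X) p g v.
have [x xv] := exists_point v; set z := base_point x.
have [zp zn] := no_entry_starts_with noe vp xv.
have act_a F z' : prng z' = v -> act_on a F z' =
    F (pact g^-1%g (iter (size p) (@ptl _ _ _ Z) z')).
  move=> z'v; have [z'p z'n] := no_entry_starts_with noe vp z'v.
  by rewrite /a /mono act_on_pmul z'p act_on_p /opP z'n srcp eqxx.
have iterk n : (iter n (@ptl _ _ _ Z) z).1.2 = - n%:Z.
  by elim: n => //= n ->; rewrite -opprD -addn1 PoszD.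
apply: simple_one_neq0.
have [I0|IT] := simple_dichotomy conjK simple (op_stable_same_path X R)
    (op_stable_zero R Z).
  have aE : a - LR_p conj X v 1%g = 0.
    apply: I0 => F NF; apply: funext => z'.
    rewrite act_onB act_on_p !fctE /opP invg1 pact1.
    case: eqP => [z'v|nz'v].
      rewrite act_a // (NF _ z') ?subrr //; apply: (circuit_same_path circ noe _ z'v).
      have [_ z'n] := no_entry_starts_with noe vp z'v.
      by rewrite prng_act z'n srcp actVK.
    rewrite subr0 /a /mono act_on_pmul.
    case: (p) p0 vp => [//|e p'] _ /andP[/eqP ev _] /=.
    by case: eqP => // ze; case: nz'v; rewrite /prng /= ze.
  (* The indicator of degree 0: [a] evaluates it at degree [- size p], which is nonzero, and [p_v]
     at degree 0. *)
  have := congr1 (fun b => act_on b (fun z' : Z => if z'.1.2 == 0 then 1 else 0) z) aE.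
  rewrite /= act_onB act_on0 !fctE act_a // act_on_p /opP xv eqxx /=.
  rewrite iterk oppr_eq0; case: (size p) p0 => //= n _.
  by rewrite sub0r => /eqP; rewrite oppr_eq0 => /eqP.
have := IT (LR_p conj X v 1%g) (fun=> 1).
rewrite act_on_p => /(_ (fun _ _ _ => erefl)) /(congr1 (fun F => F z)).
by rewrite /opP xv eqxx.
Qed.

Lemma exists_infpath_extending v p : is_path v p ->
  exists x, [/\ is_infpath x, rng (x 0%N) = v & mkseq x (size p) = p].
Proof.
elim: p v => [|e p IH] v /=.
  by move=> _; have [[x xx] xv] := exists_point v; exists x.
case/andP=> /eqP ev ep; have [x [xx xe xp]] := IH _ ep.
exists (cons_seq e x); split=> //; first by case.
by rewrite mkseq_tl /= xp.
Qed.

(** [p_(v,g)] and [p_v] agree on functions of the path alone, hence are equal by simplicity. So [g]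
    fixes the point [z], and equality of germs says that the restrictions of [g] to the prefixes of
    [x] are eventually trivial. *)
Lemma simple_strongly_fixed v g (x : nat -> edge E) : fixes_cylinder X g v ->
    is_infpath x -> rng (x 0%N) = v ->
  exists N, forall n, (N <= n)%N -> strongly_fixed X g v (mkseq x n).
Proof.
move=> fix_v xx xv; pose z := base_point (exist _ x xx).
have nz1 := simple_one_neq0.
have [I0|IT] := simple_dichotomy conjK simple (op_stable_same_path X R)
    (op_stable_zero R Z); last first.
  case: nz1; have := IT (LR_p conj X v 1%g) (fun=> 1).
  rewrite act_on_p => /(_ (fun _ _ _ => erefl)) /(congr1 (fun F => F z)).
  by rewrite /opP /prng /= /gp_hd /= xv eqxx.
have pE : LR_p conj X v g - LR_p conj X v 1%g = 0.
  apply: I0 => F NF; apply: funext => z'.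
  rewrite act_onB !act_on_p !fctE /opP invg1 pact1.
  case: eqP => [z'v|]; last by rewrite subrr.
  rewrite (NF _ z') ?subrr // /same_path; apply: infpath_eq => n /=.
  case: z' z'v => [[[y yy] k] q]; rewrite /prng /= /gp_hd /= => yv.
  by rewrite -{1}(fix_v y yy yv) -act_infM mulVg act_inf1.
(* Tested on the indicator of [z], the equality forces [g^-1] to fix [z]. *)
have := congr1 (fun b => act_on b (fun z' : Z => if `[< z' = z >] then 1 else 0) z) pE.
rewrite /= act_onB !act_on_p act_on0 !fctE /opP /prng /= /gp_hd /= xv eqxx.
rewrite invg1 gp_act1; case: asboolP => [gz _|_]; last first.
  case: asboolP => // _.
  by rewrite sub0r => /eqP; rewrite oppr_eq0 => /eqP.
have /(congr1 snd) : gp_act X g z = z.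
  by rewrite -{1}gz; exact: (@pactKV _ _ _ Z).
rewrite /= germ_mul_of => /germP[N cN]; exists N => n len.
have gx := fix_v x xx xv; split.
- by rewrite -xv -{2}gx act_rng.
- by rewrite -act_inf_prefix gx.
- by have := cN n len; rewrite mulg1.
Qed.

(** A long path is extended to an infinite one, some further prefix of which is strongly fixed; the
    bound [N], independent of the path, brings this back to the path itself. *)
Lemma simple_slack (Hfin : finitely_many_minimal_strongly_fixed X) v g :
  fixes_cylinder X g v -> slack X g v.
Proof.
move=> fix_v; have [N HN] := strongly_fixed_bounded g v Hfin.
exists N => p vp leN; have [x [xx xv xp]] := exists_infpath_extending vp.
have [M HM] := simple_strongly_fixed fix_v xx xv.
have xE : mkseq x (size p + M) = p ++ map x (iota (size p) M).
  by rewrite /mkseq iotaD map_cat -[map x (iota 0 _)]/(mkseq _ _) xp.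
apply: (HN p (map x (iota (size p) M))) => //; rewrite -xE.
  by rewrite -xv; case: (is_path_mkseq (size p + M) xx).
by apply: HM; exact: leq_addl.
Qed.

End Necessity.

Theorem proposition3p14
    (R : comPzRingType) (conj : {rmorphism R -> R}) (conjK : involutive conj)
    (G : groupType) (E : graph) (X : self_similar_triple G E)
    (Hfin : finitely_many_minimal_strongly_fixed X) :
  simple_ring (@amul R conj (LR conj X)) <->
  [/\ simple_ring (@GRing.mul R),
      weakly_G_transitive X,
      forall (g : G) (v : vert E) (p : seq (edge E)),
        G_circuit X g v p -> has_entry p &
      forall (v : vert E) (g : G), fixes_cylinder X g v -> slack X g v].
Proof.
split=> [simple|[simpleR trans entry cyl]].
  split.
  - exact: (simple_coef conjK simple).
  - exact: (simple_transitive conjK simple).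
  - exact: (simple_entry conjK simple).
  - exact: (simple_slack conjK simple Hfin).
have [v] := vert_nonempty E.
have PS := LR_family conj X.
split.
  exists (LR_p conj X v 1%g); apply: (LR_p_neq0 conjK) => one0.
  by case: simpleR => -[r nzr] _; apply: nzr; rewrite -[r]mulr1 one0 mulr0.
move=> I idI; have [I0|nI0] := pselect (forall a, I a -> a = 0).
  left; apply/seteqP; split=> a /=; first exact: I0.
  by move=> ->; case: idI.
have [a Ia nza] : exists2 a, I a & a != 0.
  apply: contrapT => none; apply: nI0 => a Ia; apply: contrapT => nza.
  by apply: none; exists a => //; apply/eqP.
have [w Iw] := ideal_vertex PS idI Hfin entry cyl (simple_ring_inv simpleR)
  (LR_tame a) (LR_runital a) Ia nza.
right; apply/seteqP; split=> b // _.
by apply: (ideal_full idI (LR_runital b)); exact: (ideal_all_vertices PS idI trans Iw).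
Qed.
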